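(* Let $\mathcal{A}$ be a hyperplane arrangement in $\mathbb{P}^3(\mathbb{R})$ consisting of $n$ hyperplanes. Assume that $\mathcal{A}$ is simply laced and that all roots of $\chi(\mathcal{A},t)$ are real. Then: (i) $h^\mathcal{A}_2 \leq 2n-2$ and $h^\mathcal{A}_3 \geq \frac{(n-4)(n-1)}{6}$. Moreover, $$\frac{(n+2)^3}{27} \geq f^\mathcal{A}_3 \geq \frac{n^3+6n+20+3 h^\mathcal{A}_2 (n+2)-2 \sqrt{\left(2n-2-h^\mathcal{A}_2\right)^3} }{27}.$$ In particular, for any sequence of such arrangements whose numbers of hyperplanes $n$ tend to infinity, $f^\mathcal{A}_3/n^3 \to \frac{1}{27}$. (ii) If $\mathcal{A}$ is simplicial, then $n \leq 119$. (iii) If $\mathcal{A}$ is a Grünbaum–Shephard arrangement, then $n \leq 15$.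
   Context: An arrangement in $\mathbb{P}^3(\mathbb{R})$ is a finite set of projective hyperplanes (images of linear hyperplanes of $\mathbb{R}^4$) with empty common intersection; it induces a cell decomposition of $\mathbb{P}^3$ whose 3-cells are chambers, $f^\mathcal{A}_3$ being their number. Each chamber is bounded by at least $4$ hyperplanes (walls); $\mathcal{A}$ is simplicial if each chamber has exactly $4$ walls. $L$ is the lattice of intersections of the corresponding linear hyperplanes in $\mathbb{R}^4$ (reverse inclusion) with Möbius function $\mu$, and $\chi(\mathcal{A},t)=\sum_{X\in L}\mu(\mathbb{R}^4,X)t^{\dim X}$. Lines are the $2$-dimensional elements of $L$; the weight of a line is the number of hyperplanes of $\mathcal{A}$ containing it, and $h^\mathcal{A}_i$ is the number of lines of weight $i$. $\mathcal{A}$ is simply laced if for every chamber $C$ and every pair of distinct walls $H,H'$ of $C$, at most three hyperplanes of $\mathcal{A}$ contain $H\cap H'$ (for arrangements in $\mathbb{P}^3$ this is equivalent to $h^\mathcal{A}_i=0$ for all $i\ge4$). $\mathcal{A}$ is a Grünbaum–Shephard arrangement if $h^\mathcal{A}_2>\sum_{i\ge3}h^\mathcal{A}_i$. *)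

(* Defs.v *)
From HB Require Import structures.
From mathcomp Require Import all_boot all_order all_algebra.
From mathcomp Require Import boolp reals.
Set Implicit Arguments. Unset Strict Implicit. Unset Printing Implicit Defensive.
Import Order.TTheory GRing.Theory Num.Theory.
Local Open Scope ring_scope.

(* An arrangement of n projective hyperplanes in P^3(R) is given by the
   normal vectors a i (rows in R^4) of the corresponding linear hyperplanes
   H_i = {x | a i *m x = 0} of R^4. *)
Section Arr.
Variables (R : realType) (n : nat) (a : 'I_n -> 'rV[R]_4).

Definition dotv (i : 'I_n) (x : 'cV[R]_4) : R := (a i *m x) 0 0.

(* nonzero normals, pairwise distinct hyperplanes, empty common intersection *)
Definition arrangement : Prop :=
  [/\ forall i, a i != 0,
      forall i j, i != j -> \rank (col_mx (a i) (a j)) = 2%N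
    & \rank (\matrix_(i < n) a i) = 4%N].

(* row space spanned by the normals of a set S of hyperplanes;
   the linear subspace /\_{i in S} H_i is its orthogonal *)
Definition spanS (S : {set 'I_n}) := (\sum_(i in S) <<a i>>)%MS.
Definition rankS (S : {set 'I_n}) : nat := \rank (spanS S).

(* hyperplanes containing /\_{i in S} H_i *)
Definition closure (S : {set 'I_n}) : {set 'I_n} :=
  [set k | (a k <= spanS S)%MS].

(* Elements X of the intersection lattice L are encoded by the (closed) set
   of hyperplanes containing X; dim X = 4 - rankS F; reverse inclusion of
   subspaces is inclusion of these sets; R^4 corresponds to set0. *)
Definition flat (F : {set 'I_n}) : bool := closure F == F.

Fixpoint mu_rec (k : nat) (F : {set 'I_n}) : int :=
  if F == set0 then 1%R else
  match k with
  | 0 => 0%R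
  | k'.+1 => - \sum_(G : {set 'I_n} | flat G && (G \proper F)) mu_rec k' G
  end.
Definition mu (F : {set 'I_n}) : int := mu_rec #|F| F.

Definition chi : {poly R} :=
  \sum_(F : {set 'I_n} | flat F) (mu F)%:~R *: 'X^(4 - rankS F).

Definition chi_real_rooted : Prop :=
  exists rs : seq R, chi = \prod_(r <- rs) ('X - r%:P).

Definition line (F : {set 'I_n}) : bool := flat F && (rankS F == 2%N).
Definition h (w : nat) : nat := #|[set F : {set 'I_n} | line F && (#|F| == w)]|.

(* chambers: a chamber of the central arrangement in R^4 is an open cone
   {x | sign(a i *m x) = s i for all i} for a realizable sign vector s
   (true = positive); chambers of P^3 are pairs of antipodal such cones. *)
Definition realizable (s : {ffun 'I_n -> bool}) : Prop :=
  exists x : 'cV[R]_4, forall i, if s i then 0 < dotv i x else dotv i x < 0.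
Definition cones : {set {ffun 'I_n -> bool}} :=
  [set s | `[< realizable s >]].
Definition f3 : nat := (#|cones| %/ 2)%N.

(* H_k is a wall of the chamber with sign vector s: the closure of the
   chamber meets H_k in a 3-dimensional set (a facet) *)
Definition wall (s : {ffun 'I_n -> bool}) (k : 'I_n) : Prop :=
  exists x : 'cV[R]_4, dotv k x = 0 /\
    forall j, j != k -> if s j then 0 < dotv j x else dotv j x < 0.
Definition walls (s : {ffun 'I_n -> bool}) : {set 'I_n} :=
  [set k | `[< wall s k >]].

Definition simplicial : Prop :=
  forall s, s \in cones -> #|walls s| = 4%N.

Definition simply_laced : Prop :=
  forall s, s \in cones -> forall k k', k != k' ->
    k \in walls s -> k' \in walls s -> (#|closure [set k; k']| <= 3)%N.

Definition grunbaum_shephard : Prop :=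
  (\sum_(3 <= i < n.+1) h i < h 2)%N.

End Arr.

(* Main.v *)
Require Import Defs.
From HB Require Import structures.
From mathcomp Require Import all_boot all_order all_algebra.
From mathcomp Require Import boolp reals.
From mathcomp Require Import zify ring lra.
Import Order.TTheory GRing.Theory Num.Theory.
(* Re-imported so that [closure] is not the one of fingraph. *)
Import Defs.
Set Implicit Arguments. Unset Strict Implicit. Unset Printing Implicit Defensive.
Local Open Scope ring_scope.

(** Write chi = t^4 - n t^3 + b2 t^2 - b3 t + b4. Since chi(1) = 0 and chi(-1) counts
    the cones (Zaslavsky: deletion-restriction applied to Whitney's sum over subsets),
    the roots 1, r1, r2, r3 give f3 = (1+r1)(1+r2)(1+r3) = n + b3. Being simply laced
    forces every line to have weight 2 or 3, so that e1 = n + 2 and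
    3 e2 = 3 (n + 2) + n (n - 1) + h2 for the numbers 1 + ri, and all bounds of (i)
    express that a real-rooted cubic satisfies e1^2 >= 3 e2, e2^2 >= 3 e1 e3 and has
    nonnegative discriminant. Part (iii) follows from the bounds on h2 and h3.

    For (ii) and the limit, n is bounded outright. In the projective plane arrangement
    of m lines around a vertex, send a line k without double points to infinity: the
    rightmost crossing in a generic affine chart is then a double point that forms an
    uncut triangle with k. A double point lies on 2 lines and has 4 sectors, hence
    there are at least m/6 double points. Thus the Moebius number of the vertex is at
    most 2 t2 (m - 2), and summing over the vertices gives f3 <= n + 2 h2 (n - 2), which
    is quadratic in n because h2 <= 2n - 2; but f3 is at least about n^3/27. *)

(** * Linear algebra of spans, closures and ranks of sets of normals *)

Section Span.
Variables (R : realType) (n : nat) (a : 'I_n -> 'rV[R]_4).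
Implicit Types S T F L G : {set 'I_n}.

Lemma sub_spanS S i : i \in S -> (a i <= spanS a S)%MS.
Proof.
move=> iS; apply: submx_trans (sumsmx_sup i _ (submx_refl _)) => //.
by rewrite genmxE.
Qed.

Lemma spanS_sub S m (B : 'M_(m, 4)) :
  (forall i, i \in S -> (a i <= B)%MS) -> (spanS a S <= B)%MS.
Proof. by move=> aB; apply/sumsmx_subP => i iS; rewrite genmxE aB. Qed.

Lemma closureP S k : reflect (a k <= spanS a S)%MS (k \in closure a S).
Proof. by rewrite inE; apply: idP. Qed.

Lemma spanS_mono S T : S \subset T -> (spanS a S <= spanS a T)%MS.
Proof. by move=> /subsetP ST; apply: spanS_sub => i /ST; apply: sub_spanS. Qed.

Lemma sub_closure S : S \subset closure a S.
Proof. by apply/subsetP => i iS; apply/closureP/sub_spanS. Qed.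

Lemma spanS_closure S : (spanS a (closure a S) :=: spanS a S)%MS.
Proof.
apply/eqmxP/andP; split; last exact/spanS_mono/sub_closure.
by apply: spanS_sub => i /closureP.
Qed.

Lemma rankS_closure S : rankS a (closure a S) = rankS a S.
Proof. by rewrite /rankS spanS_closure. Qed.

Lemma closure_mono S T : S \subset T -> closure a S \subset closure a T.
Proof.
move=> ST; apply/subsetP => i /closureP iS; apply/closureP.
exact: submx_trans iS (spanS_mono ST).
Qed.

Lemma closureK S : closure a (closure a S) = closure a S.
Proof. by apply/setP => i; rewrite !inE spanS_closure. Qed.

Lemma flat_closure S : flat a (closure a S).
Proof. by rewrite /flat closureK. Qed.

Lemma closure_flat F : flat a F -> closure a F = F.
Proof. by move/eqP. Qed.

Lemma closure_sub_flat S F : flat a F -> (closure a S \subset F) = (S \subset F).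
Proof.
move=> fF; apply/idP/idP; first exact: subset_trans (sub_closure _).
by move=> /closure_mono; rewrite (closure_flat fF).
Qed.

Lemma rankS_mono S T : S \subset T -> (rankS a S <= rankS a T)%N.
Proof. by move=> ST; apply: mxrankS; apply: spanS_mono. Qed.

Lemma closure_eq_rank S F :
  flat a F -> S \subset F -> rankS a S = rankS a F -> closure a S = F.
Proof.
move=> fF SF eqr; have /eqmxP e : (spanS a S == spanS a F)%MS.
  by rewrite -(geq_leqif (mxrank_leqif_eq (spanS_mono SF))) -[X in (X <= _)%N]/(rankS a F) -eqr.
by rewrite -[RHS](closure_flat fF); apply/setP => i; rewrite !inE e.
Qed.

Lemma rankS0 : rankS a set0 = 0%N.
Proof. by rewrite /rankS /spanS big_set0 mxrank0. Qed.

Lemma rankS_le4 S : (rankS a S <= 4)%N.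
Proof. exact: rank_leq_col. Qed.

Lemma spanS_setU1 k S : (spanS a (k |: S) :=: a k + spanS a S)%MS.
Proof.
apply/eqmxP/andP; split; last first.
  rewrite addsmx_sub sub_spanS ?setU11 //= spanS_mono //.
  by rewrite subsetUr.
apply: spanS_sub => i /setU1P[->|iS]; first exact: addsmxSl.
by apply: submx_trans (addsmxSr _ _); apply: sub_spanS.
Qed.

Lemma rankS_setU1_le k S : (rankS a (k |: S) <= (rankS a S).+1)%N.
Proof.
rewrite /rankS spanS_setU1 (leq_trans (mxrank_adds_leqif _ _)) //.
by have := rank_leq_row (a k); lia.
Qed.

Lemma rankS_setU1 k S : k \notin closure a S -> rankS a (k |: S) = (rankS a S).+1.
Proof.
move=> /closureP kS; apply/eqP; rewrite eqn_leq rankS_setU1_le /= ltn_neqAle.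
rewrite rankS_mono ?subsetUr // andbT; apply/eqP => e; apply: kS.
have := spanS_setU1 k S; have /mxrank_leqif_eq/geq_leqif := spanS_mono (subsetUr [set k] S).
rewrite -!/(rankS _ _) -e leqnn => /esym/eqmxP e2 e3.
by rewrite e2 e3 addsmxSl.
Qed.

Lemma spanS1 i : (spanS a [set i] :=: a i)%MS.
Proof. by rewrite /spanS big_set1; apply: genmxE. Qed.

Lemma spanS2P i j (v : 'rV_4) :
  (v <= spanS a [set i; j])%MS -> exists al be, v = al *: a i + be *: a j.
Proof.
rewrite spanS_setU1 => /sub_addsmxP[[B C] /= ->].
have /submxP[D ->] : (C *m spanS a [set j] <= a j)%MS by rewrite -spanS1 submxMl.
exists (B 0 0), (D 0 0).
by rewrite {1}[B]mx11_scalar {1}[D]mx11_scalar !mul_scalar_mx.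
Qed.

Lemma spanS3P i j k (v : 'rV_4) :
  (v <= spanS a (i |: [set j; k]))%MS ->
  exists al be ga, v = al *: a i + be *: a j + ga *: a k.
Proof.
rewrite spanS_setU1 => /sub_addsmxP[[B C] /= ->].
have [al [be ->]] := spanS2P (submxMl C (spanS a [set j; k])).
exists (B 0 0), al, be; by rewrite -addrA {1}[B]mx11_scalar mul_scalar_mx.
Qed.

Lemma dotvD i x y : dotv a i (x + y) = dotv a i x + dotv a i y.
Proof. by rewrite /dotv mulmxDr mxE. Qed.

Lemma dotvZ i c x : dotv a i (c *: x) = c * dotv a i x.
Proof. by rewrite /dotv -scalemxAr mxE. Qed.

Lemma dotv_comb2 i j k x al be : a k = al *: a i + be *: a j ->
  dotv a k x = al * dotv a i x + be * dotv a j x.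
Proof. by move=> e; rewrite /dotv e mulmxDl -!scalemxAl !mxE. Qed.

Lemma dotv_comb3 h i j k x al be ga : a h = al *: a i + be *: a j + ga *: a k ->
  dotv a h x = al * dotv a i x + be * dotv a j x + ga * dotv a k x.
Proof. by move=> e; rewrite /dotv e !mulmxDl -!scalemxAl !mxE. Qed.

Lemma rv_neq0_dual (v : 'rV[R]_4) : v != 0 -> exists x : 'cV[R]_4, (v *m x) 0 0 = 1.
Proof.
move=> /rV0Pn[j vj]; exists ((v 0 j)^-1 *: delta_mx j 0).
by rewrite -scalemxAr mxE -colE mxE mulVf.
Qed.

(** The columns of the cokernel of [spanS a S] are orthogonal to all normals in [S]. Some column is
    not orthogonal to [a k], and rescaling it gives the point. *)
Lemma exists_dual S k : k \notin closure a S ->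
  exists x : 'cV[R]_4, (forall i, i \in S -> dotv a i x = 0) /\ dotv a k x = 1.
Proof.
rewrite inE submxE.
have aS i : i \in S -> a i *m cokermx (spanS a S) = 0.
  by move=> /sub_spanS; rewrite submxE => /eqP.
move: (cokermx _) aS => C aS /rV0Pn[j kj].
exists (((a k *m C) 0 j)^-1 *: (C *m delta_mx j 0)); split=> [i iS|].
  by rewrite dotvZ /dotv mulmxA (aS i iS) mul0mx [X in _ * X]mxE mulr0.
by rewrite dotvZ /dotv mulmxA -colE [X in _ * X]mxE mulVf.
Qed.

End Span.

(** * Pairing the subsets that contain an element with those that avoid it *)

Section SubsetSums.
Variables (I : finType) (M : zmodType).

Lemma sum_subset_setU1 (k : I) (S : {set I}) (f : {set I} -> M) : k \notin S ->
  \sum_(T : {set I} | T \subset k |: S) f T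
  = \sum_(T : {set I} | T \subset S) (f T + f (k |: T)).
Proof.
move=> kS; rewrite (bigID (fun T : {set I} => k \in T)) /= addrC big_split /=; congr (_ + _).
  apply: eq_bigl => T; rewrite -subsetD1 setU1K //.
rewrite (reindex_onto (fun T => k |: T) (fun T => T :\ k)) /=; last first.
  by move=> T /andP[_ kT]; rewrite setD1K.
apply: eq_bigl => T; rewrite setU11 andbT; apply/andP/idP.
  move=> [TS /eqP eT]; have kT : k \notin T by rewrite -eT setD11.
  by rewrite -(setU1K kS) subsetD1 kT (subset_trans (subsetUr _ _) TS).
move=> TS; have kT : k \notin T by apply: contra kS; apply/subsetP.
by rewrite setU1K // eqxx setUS.
Qed.

End SubsetSums.

(** * Strict signs: convexity and stability under small perturbations *)

Section Signs.
Variable R : realType.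

Definition has_sign (b : bool) (r : R) : bool := if b then 0 < r else r < 0.

Lemma has_sign_neq0 b r : has_sign b r -> r != 0.
Proof. by case: b => /= rb; [exact: lt0r_neq0 | exact: ltr0_neq0]. Qed.

Lemma has_sign_gt0 r : r != 0 -> has_sign (0 < r) r.
Proof. by rewrite /has_sign; case: ltrgt0P. Qed.

Lemma has_sign_convex b r r' t t' : 0 < t -> 0 < t' ->
  has_sign b r -> has_sign b r' -> has_sign b (t * r + t' * r').
Proof. by case: b => /=; nra. Qed.

Lemma has_sign_near b r w : has_sign b r ->
  exists2 e : R, 0 < e & forall t, `|t| <= e -> has_sign b (r + t * w).
Proof.
move=> br; have r0 : 0 < `|r| by rewrite normr_gt0 (has_sign_neq0 br).
have w1 : 0 < `|w| + 1 by rewrite ltr_wpDl.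
(* The summand 1 keeps the denominator positive when [w] is zero. *)
exists (`|r| / (`|w| + 1)); first exact: divr_gt0.
move=> t; rewrite ler_pdivlMr // => te.
have tw : `|t * w| < `|r| \/ t = 0.
  have [->|t0] := eqVneq t 0; [by right | left; apply: lt_le_trans te].
  by rewrite normrM ltr_pM2l ?normr_gt0 // ltrDl.
case: tw => [|->]; last by rewrite mul0r addr0.
move: br; case: b => /= br; rewrite ltr_norml => /andP[]; last first.
  by rewrite ltr0_norm // => _; lra.
by rewrite gtr0_norm //; lra.
Qed.

Lemma near_all (I : eqType) (s : seq I) (P : I -> R -> Prop) :
  (forall i, i \in s -> exists2 e : R, 0 < e & forall t, `|t| <= e -> P i t) ->
  exists2 e : R, 0 < e & forall t, `|t| <= e -> forall i, i \in s -> P i t.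
Proof.
elim: s => [|j s IH] Ps; first by exists 1.
have [e e0 Pe] := Ps j (mem_head _ _).
have [|e' e0' Pe'] := IH; first by move=> i si; apply: Ps; rewrite in_cons si orbT.
exists (Num.min e e') => [|t]; first by rewrite lt_min e0.
rewrite le_min => /andP[te te'] i; rewrite in_cons => /predU1P[->|si]; first exact: Pe.
exact: Pe'.
Qed.

End Signs.

(** * Zaslavsky's theorem by deletion and restriction *)

Section Zaslavsky.
Variables (R : realType) (n : nat).
Implicit Types (a : 'I_n -> 'rV[R]_4) (S T : {set 'I_n}) (s : {ffun 'I_n -> bool}).

Definition realizes a S s (x : 'cV[R]_4) : Prop :=
  forall i, i \in S -> has_sign (s i) (dotv a i x).

Lemma realizes_near a S s x v : realizes a S s x ->
  exists2 e : R, 0 < e & forall t, `|t| <= e -> realizes a S s (x + t *: v).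
Proof.
move=> xS.
have [|e e0 He] := @near_all R _ (enum S)
  (fun i t => has_sign (s i) (dotv a i (x + t *: v))).
  move=> i; rewrite mem_enum => /xS /(has_sign_near (dotv a i v)) [e e0 He].
  by exists e => // t /He; rewrite dotvD dotvZ.
by exists e => // t te i iS; apply: He => //; rewrite mem_enum.
Qed.

(* Sign vectors on the subarrangement indexed by S, extended by false. *)
Definition cones_on a S : {set {ffun 'I_n -> bool}} :=
  [set s : {ffun 'I_n -> bool} | [forall i, s i ==> (i \in S)] && `[< exists x, realizes a S s x >]].

Lemma cones_onP a S s :
  reflect ((forall i, s i -> i \in S) /\ exists x, realizes a S s x)
          (s \in cones_on a S).
Proof.
rewrite inE; apply: (iffP andP) => -[sS /asboolP ex]; split=> //.
  by move=> i si; move/forallP/(_ i)/implyP: sS; apply.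
by apply/forallP => i; apply/implyP/sS.
Qed.

(** By Whitney's formula this is the value at -1 of the characteristic polynomial in dimension 4.
    The sum over all subsets, rather than over flats, stays meaningful when normals vanish or
    coincide, as may happen after a restriction. *)
Definition whitney_sum a S : int :=
  \sum_(T : {set 'I_n} | T \subset S) (-1) ^+ (#|T| + rankS a T).

(** Restriction to H_k without a change of ambient space: when [dotv a k v = 1], the new normals
    vanish on [v] and agree with the old ones on H_k. *)
Definition contract a k v i := a i - dotv a i v *: a k.

Lemma dotv_contract a k v i x :
  dotv (contract a k v) i x = dotv a i x - dotv a i v * dotv a k x.
Proof. by rewrite /dotv /contract /dotv mulmxBl -scalemxAl !mxE. Qed.

(** The contracted normals are killed by [v] and [a k] is not, so the line spanned by [a k] meets
    their span trivially. *)
Lemma rankS_contract a k v T : dotv a k v = 1 ->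
  rankS a (k |: T) = (rankS (contract a k v) T).+1.
Proof.
move=> kv1; set W := spanS (contract a k v) T.
have -> : rankS a (k |: T) = \rank (a k + W)%MS.
  rewrite /rankS spanS_setU1; apply/eqmx_rank/andP; split.
    rewrite addsmx_sub addsmxSl /=; apply: spanS_sub => i iT.
    rewrite -[a i](subrK (dotv a i v *: a k)) addmx_sub //.
      by apply: submx_trans (addsmxSr _ _); apply: (@sub_spanS _ _ (contract a k v)).
    by rewrite (submx_trans _ (addsmxSl _ _)) // scalemx_sub.
  rewrite addsmx_sub addsmxSl /=; apply: spanS_sub => i iT.
  rewrite /contract addmx_sub //.
    by apply: submx_trans (addsmxSr _ _); apply: sub_spanS.
  by rewrite eqmx_opp (submx_trans _ (addsmxSl _ _)) // scalemx_sub.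
have Wv : W *m v = 0.
  apply/eqP; rewrite -sub_kermx; apply: spanS_sub => i _; rewrite sub_kermx.
  apply/eqP/matrixP => p q; rewrite !ord1 -/(dotv (contract a k v) i v).
  by rewrite dotv_contract kv1 mulr1 subrr mxE.
rewrite mxrank_disjoint_sum.
  by rewrite rank_rV; case: eqP kv1 => // k0; rewrite /dotv k0 mul0mx mxE => /eqP; rewrite eq_sym oner_eq0.
apply/eqP; rewrite -submx0; apply/rV_subP => u; rewrite sub_capmx => /andP[/sub_rVP[c ->]].
move=> /submxP[D /(congr1 (mulmx^~ v))]; rewrite -mulmxA Wv mulmx0 -scalemxAl.
move/matrixP/(_ 0 0); rewrite mxE -/(dotv a k v) kv1 mulr1 mxE => ->.
by rewrite scale0r sub0mx.
Qed.

(** [T] and [k |: T] have equal rank and opposite parity, so their terms cancel. *)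
Lemma whitney_sum_zero a k S : k \notin S -> a k = 0 -> whitney_sum a (k |: S) = 0.
Proof.
move=> kS k0; rewrite /whitney_sum sum_subset_setU1 // big1 // => T TS.
have kT : k \notin T by apply: contra kS; apply/subsetP.
have -> : rankS a (k |: T) = rankS a T.
  by rewrite /rankS spanS_setU1 k0 adds0mx.
by rewrite cardsU1 kT add1n addSn exprS mulN1r subrr.
Qed.

Lemma whitney_sum_contract a k v S : k \notin S -> dotv a k v = 1 ->
  whitney_sum a (k |: S) = whitney_sum a S + whitney_sum (contract a k v) S.
Proof.
move=> kS kv1; rewrite /whitney_sum sum_subset_setU1 // big_split /=; congr (_ + _).
apply: eq_bigr => T TS; have kT : k \notin T by apply: contra kS; apply/subsetP.
by rewrite (rankS_contract _ kv1) cardsU1 kT add1n addSn addnS !exprS !mulN1r opprK.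
Qed.

(** Let [C b] collect the cones of [S] that meet the side [b] of H_k. Their union consists of all
    cones of [S], their intersection of the cones of the restriction, and the sum of their sizes
    counts the cones of [k |: S]. *)
Lemma cones_on_contract a k v S : k \notin S -> dotv a k v = 1 ->
  #|cones_on a (k |: S)| = (#|cones_on a S| + #|cones_on (contract a k v) S|)%N.
Proof.
move=> kS kv1.
have neq i : i \in S -> i != k by move=> iS; apply: contra kS => /eqP <-.
pose C b := [set s : {ffun 'I_n -> bool} | [forall i, s i ==> (i \in S)] &&
  `[< exists x, realizes a S s x /\ has_sign b (dotv a k x) >]].
have CP b s : reflect ((forall i, s i -> i \in S) /\
    exists x, realizes a S s x /\ has_sign b (dotv a k x)) (s \in C b).
  rewrite inE; apply: (iffP andP) => -[sS /asboolP ex]; split=> //.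
    by move=> i si; move/forallP/(_ i)/implyP: sS; apply.
  by apply/forallP => i; apply/implyP/sS.
(* Cones are open, so a representative on H_k can be pushed along [v] to the positive side. *)
have -> : cones_on a S = C true :|: C false.
  apply/setP => s; rewrite in_setU; apply/cones_onP/orP.
    move=> [sS [x xs]]; have [e e0 He] := realizes_near v xs.
    have [k0|k0|k0] := ltrgtP (dotv a k x) 0.
    - by right; apply/CP; split=> //; exists x.
    - by left; apply/CP; split=> //; exists x.
    left; apply/CP; split=> //; exists (x + e *: v); split.
      by apply: He; rewrite gtr0_norm.
    by rewrite /= dotvD dotvZ k0 kv1 mulr1 add0r.
  by case=> /CP[sS [x [xs _]]]; split=> //; exists x.
(* A point for the restriction is projected along [v] onto H_k and then pushed to either side.
   Conversely, the segment between points on the two sides crosses H_k. *)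
have -> : cones_on (contract a k v) S = C true :&: C false.
  apply/setP => s; rewrite in_setI; apply/cones_onP/andP.
    move=> [sS [x xs]].
    have xs' : realizes a S s (x - dotv a k x *: v).
      move=> i iS; have := xs i iS.
      by rewrite dotv_contract dotvD -scaleNr dotvZ mulNr [dotv a k x * _]mulrC.
    have [e e0 He] := realizes_near v xs'.
    split; apply/CP; split=> //; [exists (x - dotv a k x *: v + e *: v)
      | exists (x - dotv a k x *: v + (- e) *: v)]; split.
    - by apply: He; rewrite gtr0_norm.
    - by rewrite /= !dotvD -scaleNr !dotvZ kv1 !mulr1 subrr add0r.
    - by apply: He; rewrite normrN gtr0_norm.
    - by rewrite /= !dotvD -!scaleNr !dotvZ kv1 !mulr1 subrr add0r oppr_lt0.
  move=> [/CP[sS [x [xs /= x0]]] /CP[_ [y [ys /= y0]]]]; split=> //.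
  exists ((- dotv a k y) *: x + dotv a k x *: y) => i iS.
  rewrite dotv_contract !dotvD !dotvZ [- _ * dotv a k x]mulNr [dotv a k y * _]mulrC addNr mulr0 subr0.
  by apply: has_sign_convex; [lra|lra|exact: xs|exact: ys].
(* The sign vectors that are false at [k] form [C false]; those that are true at [k] match [C true]
   through [set_k]. *)
rewrite cardsUI -(cardsID [set s : {ffun 'I_n -> bool} | s k]); congr (_ + _)%N; last first.
  apply: eq_card => s; apply/idP/CP.
    rewrite in_setD inE => /andP[/negPf sk /cones_onP[sS [x xs]]]; split.
      by move=> i si; have /setU1P[ik|//] := sS i si; rewrite -ik si in sk.
    exists x; split; last by have := xs k (setU11 _ _); rewrite sk.
    by move=> i iS; apply: xs; rewrite setU1r.
  move=> [sS [x [xs xk]]]; have sk : s k = false by apply/negP => /sS; rewrite (negPf kS).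
  rewrite in_setD inE sk /=; apply/cones_onP; split=> [i /sS iS|]; first exact: setU1r.
  by exists x => i /setU1P[->|/xs//]; rewrite sk.
pose set_k (s : {ffun 'I_n -> bool}) := [ffun i => (i == k) || s i].
rewrite -(card_in_imset (f := set_k) (D := C true)); last first.
  move=> s t /CP[sS _] /CP[tS _] /ffunP e; apply/ffunP => i; have := e i; rewrite !ffunE.
  have [->|//] := eqVneq i k.
  by case: (s k) (sS k) (t k) (tS k) => [/(_ isT)|] + [/(_ isT)|] => //; rewrite (negPf kS).
apply: eq_card => s; apply/idP/imsetP.
  rewrite in_setI => /andP[/cones_onP[sS [x xs]]]; rewrite inE => sk.
  exists [ffun i => (i != k) && s i].
    apply/CP; split; first by move=> i; rewrite ffunE => /andP[/negPf ik /sS/setU1P[/eqP|//]]; rewrite ik.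
    exists x; split; last by have := xs k (setU11 _ _); rewrite sk.
    by move=> i iS; rewrite ffunE neq //; apply: xs; rewrite setU1r.
  apply/ffunP => i; rewrite !ffunE; by have [->|] := eqVneq i k.
move=> [t /CP[tS [x [xt xk]]] ->]; rewrite in_setI inE ffunE eqxx andbT.
apply/cones_onP; split.
  move=> i; rewrite ffunE => /orP[/eqP->|/tS iS]; [exact: setU11 | exact: setU1r].
exists x => i /setU1P[->|iS]; rewrite ffunE; first by rewrite eqxx.
by rewrite (negPf (neq i iS)); apply: xt.
Qed.

Theorem zaslavsky_on a S : (#|cones_on a S|)%:Z = whitney_sum a S.
Proof.
have [m] := ubnP #|S|; elim: m => // m IH in a S * => Sm.
have [->|[k kS]] := set_0Vmem S.
  rewrite /whitney_sum (eq_bigl (pred1 set0)); last by move=> T; rewrite subset0.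
  rewrite big_pred1_eq cards0 rankS0 expr0; apply: (congr1 Posz).
  rewrite -(cards1 [ffun i : 'I_n => false]).
  apply: eq_card => s; rewrite in_set1; apply/cones_onP/eqP => [[sS _]|->].
    by apply/ffunP => i; rewrite ffunE; apply/negP => /sS; rewrite inE.
  by split=> [i|]; [rewrite ffunE | exists 0 => i; rewrite inE].
have kS' : k \notin S :\ k by rewrite setD11.
have Sm' : (#|S :\ k| < m)%N by move: Sm; rewrite (cardsD1 k S) kS.
(* A restriction may have produced a zero normal; then no strict sign exists at [k] and both sides
   are 0. *)
rewrite -(setD1K kS); have [k0|k0] := eqVneq (a k) 0.
  rewrite whitney_sum_zero //; congr (Posz _); apply/eqP; rewrite cards_eq0.
  apply/eqP/setP => s; rewrite in_set0; apply/negP => /cones_onP[_ [x /(_ k (setU11 _ _))]].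
  by move/has_sign_neq0; rewrite /dotv k0 mul0mx mxE eqxx.
have [v kv] := rv_neq0_dual k0.
by rewrite (cones_on_contract kS' kv) (whitney_sum_contract kS' kv) PoszD !IH.
Qed.

End Zaslavsky.

Lemma alternating_subset_sum (I : finType) (F : {set I}) :
  \sum_(S : {set I} | S \subset F) (-1) ^+ #|S| = (F == set0)%:Z.
Proof.
have [->|[k kF]] := set_0Vmem F.
  by rewrite eqxx (eq_bigl (pred1 set0)) ?big_pred1_eq ?cards0 // => T; rewrite subset0.
rewrite -(setD1K kF) sum_subset_setU1 ?setD11 // big1 => [|T TF].
  by case: eqP => // /setP/(_ k); rewrite setU11 inE.
have kT : k \notin T by apply/negP => /(subsetP TF); rewrite setD11.
by rewrite cardsU1 kT exprS mulN1r subrr.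
Qed.

(** * Moebius function of the intersection lattice and coefficients of chi *)

Section Moebius.
Variables (R : realType) (n : nat) (a : 'I_n -> 'rV[R]_4).
Hypothesis arr : arrangement a.
Implicit Types S T F L G : {set 'I_n}.

Lemma normal_neq0 i : a i != 0. Proof. by case: arr. Qed.

Lemma closure0 : closure a set0 = set0.
Proof.
apply/setP => i; rewrite in_set0; apply/closureP.
rewrite /spanS big_set0 submx0; exact/negP/normal_neq0.
Qed.

Lemma flat0 : flat a set0. Proof. exact/eqP/closure0. Qed.

Lemma rankS_set1 i : rankS a [set i] = 1%N.
Proof. by rewrite -[[set i]]setU0 rankS_setU1 ?rankS0 // closure0 inE. Qed.

Lemma rankS_set2 i j : i != j -> rankS a [set i; j] = 2%N.
Proof.
move=> ij; have [_ r2 _] := arr; apply: etrans (r2 i j ij).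
apply: eqmx_rank; apply/eqmxP; apply: eqmx_trans (spanS_setU1 _ _ _) _.
apply: eqmx_trans (addsmxE _ _); exact: adds_eqmx (eqmx_refl _) (spanS1 _ _).
Qed.

Lemma closure1 i : closure a [set i] = [set i].
Proof.
apply/eqP; rewrite eqEsubset sub_closure andbT; apply/subsetP => j ji.
rewrite in_set1; apply/negP => /negP ji'.
have : (rankS a [set j; i] <= rankS a (closure a [set i]))%N.
  apply: rankS_mono; apply/subsetP => l /set2P[]-> //.
  by rewrite (subsetP (sub_closure _ _)) ?set11.
by rewrite rankS_set2 // rankS_closure rankS_set1.
Qed.

Lemma flatT : flat a setT.
Proof. by rewrite /flat eqEsubset subsetT sub_closure. Qed.

Lemma rankST : rankS a setT = 4%N.
Proof.
have [_ _ r4] := arr; apply: etrans r4; apply: eqmx_rank; apply/andP; split.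
  by apply: spanS_sub => i _; rewrite -(rowK a i) row_sub.
by apply/row_subP => i; rewrite rowK sub_spanS ?inE.
Qed.

Lemma flat_rank0 F : flat a F -> (rankS a F == 0%N) = (F == set0).
Proof.
move=> fF; have [->|[k kF]] := set_0Vmem F; first by rewrite rankS0 !eqxx.
have -> : (F == set0) = false by apply/negP => /eqP F0; rewrite F0 inE in kF.
by have := rankS_mono a (_ : [set k] \subset F); rewrite sub1set rankS_set1 => /(_ kF); case: rankS.
Qed.

Lemma flat_rank1P F : reflect (exists i, F = [set i]) (flat a F && (rankS a F == 1%N)).
Proof.
apply: (iffP andP) => [[fF /eqP r1]|[i ->]]; last first.
  by rewrite rankS_set1 /flat closure1 !eqxx.
have [F0|[k kF]] := set_0Vmem F; first by rewrite F0 rankS0 in r1.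
by exists k; rewrite -(closure_eq_rank fF (_ : [set k] \subset F)) ?sub1set ?closure1 ?rankS_set1.
Qed.

Lemma line_closure L i j : line a L -> i \in L -> j \in L -> i != j ->
  closure a [set i; j] = L.
Proof.
move=> /andP[fL /eqP r2] iL jL ij; apply: closure_eq_rank => //.
  by apply/subsetP => l /set2P[]->.
by rewrite rankS_set2.
Qed.

Lemma line_closure2 i j : i != j -> line a (closure a [set i; j]).
Proof. by move=> ij; rewrite /line flat_closure rankS_closure rankS_set2. Qed.

Lemma flat_proper_rank G F : flat a G -> flat a F ->
  (G \proper F) = (G \subset F) && (rankS a G < rankS a F)%N.
Proof.
move=> fG fF; rewrite properEneq andbC; apply: andb_id2l => GF.
rewrite ltn_neqAle rankS_mono // andbT; congr (~~ _); apply/eqP/eqP => [->//|].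
by move/(closure_eq_rank fF GF); rewrite closure_flat.
Qed.

Lemma line_card_gt1 L : line a L -> (1 < #|L|)%N.
Proof.
move=> /andP[fL /eqP r2]; rewrite ltnNge; apply/negP => L1.
have [L0|[k kL]] := set_0Vmem L; first by rewrite L0 rankS0 in r2.
have Lk : [set k] = L by apply/eqP; rewrite eqEcard sub1set kL cards1.
by rewrite -Lk rankS_set1 in r2.
Qed.

(** The first argument of [mu_rec] is only fuel: any amount at least the size of the set gives the
    same value. *)
Lemma mu_recE k F : (#|F| <= k)%N -> mu_rec a k F = mu a F.
Proof.
rewrite /mu; elim/ltn_ind: k F => k IH F Fk.
case: k => [|k] in IH Fk *; first by move: Fk; rewrite leqn0 => /eqP ->.
case EF: #|F| => [|m] /=.
  by move/eqP: EF; rewrite cards_eq0 => ->.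
case: eqP => // _; congr (- _); apply: eq_bigr => G /andP[_ /proper_card GF].
rewrite IH ?ltnSn //; last by rewrite -ltnS (leq_trans GF).
by rewrite [RHS]IH //; [move: Fk; rewrite EF | rewrite -ltnS -EF].
Qed.

Lemma mu0 : mu a set0 = 1.
Proof. by rewrite /mu cards0 /= eqxx. Qed.

Lemma muE F : F != set0 -> mu a F = - \sum_(G | flat a G && (G \proper F)) mu a G.
Proof.
move=> F0; have : (0 < #|F|)%N by rewrite card_gt0.
rewrite {1}/mu; case EF: #|F| => [//|m] _ /=; rewrite (negPf F0); congr (- _).
by apply: eq_bigr => G /andP[_ /proper_card GF]; rewrite mu_recE // -ltnS -EF.
Qed.

Lemma mu_sum F : flat a F -> \sum_(G | flat a G && (G \subset F)) mu a G = (F == set0)%:Z.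
Proof.
move=> fF; have [F0|F0] := eqVneq F set0.
  rewrite F0 (eq_bigl (pred1 set0)) ?big_pred1_eq ?mu0 // => G.
  by rewrite subset0 /=; case: eqP => [->|]; rewrite ?flat0 ?andbF.
rewrite (bigD1 F) /= ?fF ?subxx // muE // addrC; apply/eqP; rewrite subr_eq0; apply/eqP.
by apply: eq_bigl => G; rewrite properEneq -andbA [(G != F) && _]andbC.
Qed.

(** Whitney's theorem: both sides satisfy the recursion of [mu_sum], the right one after grouping
    the alternating sum over the subsets of [F] by closure. *)
Lemma mu_whitney F : flat a F -> mu a F = \sum_(S | closure a S == F) (-1) ^+ #|S|.
Proof.
have [m] := ubnP #|F|; elim: m => // m IH in F * => Fm fF.
have := mu_sum fF; rewrite -alternating_subset_sum.
rewrite [X in _ = X -> _](partition_big (closure a) (fun G => flat a G && (G \subset F))) /=; last first.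
  by move=> S SF; rewrite flat_closure closure_sub_flat.
rewrite (bigD1 F) /= ?fF ?subxx // [X in _ = X -> _](bigD1 F) /= ?fF ?subxx //.
rewrite [X in _ + X = _ -> _](eq_bigr (fun G => \sum_(S : {set 'I_n} | (S \subset F) && (closure a S == G)) (-1) ^+ #|S|)).
  move/addIr => ->; apply: eq_bigl => S.
  by case: eqP => [<-|]; rewrite ?andbF // andbT sub_closure.
move=> G /andP[/andP[fG GF] GnF]; rewrite IH //.
  apply: eq_bigl => S; case: eqP => [SG|]; rewrite ?andbF // andbT.
  by rewrite -(closure_sub_flat _ fF) SG.
by rewrite -ltnS (leq_trans _ Fm) // ltnS proper_card // properEneq GnF.
Qed.

Lemma cones_onT : cones_on a setT = cones a.
Proof.
apply/setP => s; rewrite [in RHS]inE; apply/cones_onP/asboolP.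
  by move=> [_ [x xs]]; exists x => i; have := xs i (in_setT _); rewrite /has_sign; case: (s i).
move=> [x xs]; split=> // [i|]; first by rewrite inE.
by exists x => i _; have := xs i; rewrite /has_sign; case: (s i).
Qed.

Lemma zaslavsky : (#|cones a|)%:Z = \sum_(F | flat a F) mu a F * (-1) ^+ rankS a F.
Proof.
rewrite -cones_onT zaslavsky_on /whitney_sum.
rewrite (partition_big (closure a) (flat a)) /=; last by move=> S _; apply: flat_closure.
apply: eq_bigr => F fF; rewrite mu_whitney // mulr_suml.
apply: eq_big => [S|S /andP[_ /eqP SF]]; first by rewrite subsetT.
by rewrite exprD -SF rankS_closure.
Qed.

(** For a flat [F] this is the signed coefficient of t^(4-r) in the characteristic polynomial of the
    subarrangement [F]; [F = setT] gives chi itself. *)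
Definition level (r : nat) F : int :=
  \sum_(G | flat a G && (G \subset F) && (rankS a G == r)) mu a G.

Lemma sum_by_rank (M : nmodType) (P : pred {set 'I_n}) (f : {set 'I_n} -> M) :
  \sum_(G | P G) f G = \sum_(r < 5) \sum_(G | P G && (rankS a G == r)) f G.
Proof.
rewrite (partition_big (fun G => inord (rankS a G) : 'I_5) xpredT) //=.
apply: eq_bigr => r _; apply: eq_bigl => G; congr (_ && _).
by rewrite -val_eqE /= inordK // ltnS rankS_le4.
Qed.

Lemma mu_level F : flat a F -> F != set0 ->
  mu a F = - \sum_(r < rankS a F) level r F.
Proof.
move=> fF F0; rewrite muE // sum_by_rank; congr (- _).
rewrite (big_ord_widen 5 (fun r => level r F)) ?(leqW (rankS_le4 _ _)) // [RHS]big_mkcond.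
apply: eq_bigr => r _; case: ifP => rF.
  apply: eq_bigl => G; case: (boolP (flat a G)) => //= fG.
  by rewrite flat_proper_rank //; case: eqP => [->|]; rewrite ?andbF // rF andbT.
rewrite big1 // => G /andP[/andP[fG]]; rewrite flat_proper_rank // => /andP[_ +] /eqP e.
by rewrite e rF.
Qed.

Lemma level0 F : level 0 F = 1.
Proof.
rewrite /level (eq_bigl (pred1 set0)) ?big_pred1_eq ?mu0 // => G /=.
case: (boolP (flat a G)) => [/flat_rank0->|fG]; first by case: eqP => [->|]; rewrite ?sub0set ?andbF.
by apply/esym; apply: contraNF fG => /eqP->; apply: flat0.
Qed.

Lemma mu_rank1 F : flat a F -> rankS a F = 1%N -> mu a F = -1.
Proof.
move=> fF r1; rewrite mu_level // ?r1 ?big_ord1 ?level0 //.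
by rewrite -flat_rank0 // r1.
Qed.

Lemma level1 F : level 1 F = - (#|F|)%:Z.
Proof.
rewrite /level (eq_bigr (fun=> -1)); last first.
  by move=> G /andP[/andP[fG _] /eqP r1]; rewrite mu_rank1.
rewrite sumr_const mulNrn -natz; congr (- (_ *+ _)).
rewrite -(card_imset F (@set1_inj _)); apply: eq_card => G.
rewrite [LHS]unfold_in /= -andbA [(G \subset F) && _]andbC andbA.
apply/andP/imsetP => [[/flat_rank1P[i ->]]|[i iF ->]].
  by rewrite sub1set => iF; exists i.
by split; [apply/flat_rank1P; exists i | rewrite sub1set].
Qed.

Lemma mu_line L : line a L -> mu a L = (#|L|)%:Z - 1.
Proof.
move=> /andP[fL /eqP r2]; rewrite mu_level // ?r2.
  by rewrite big_ord_recr big_ord1 /= level0 level1; ring.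
by rewrite -flat_rank0 // r2.
Qed.

Lemma level2 F : level 2 F = \sum_(L | line a L && (L \subset F)) ((#|L|)%:Z - 1).
Proof.
apply: eq_big => [G|G /andP[/andP[fG _] rG]]; first by rewrite /line andbAC.
by rewrite mu_line // /line fG.
Qed.

Lemma mu_rank3 F : flat a F -> rankS a F = 3%N ->
  mu a F = - (1 - (#|F|)%:Z + level 2 F).
Proof.
move=> fF r3; rewrite mu_level // ?r3; last by rewrite -flat_rank0 // r3.
by rewrite 2!big_ord_recr big_ord1 /= level0 level1.
Qed.

Lemma chi_level : chi a = \sum_(r < 5) (level r setT)%:~R *: 'X^(4 - r).
Proof.
rewrite /chi sum_by_rank; apply: eq_bigr => r _.
rewrite /level rmorph_sum /= scaler_suml; apply: eq_big => [G|G /andP[_ /eqP->]] //.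
by rewrite subsetT andbT.
Qed.

(** This is chi(1) = 0. *)
Lemma sum_level : \sum_(r < 5) level r setT = 0.
Proof.
have := mu_sum flatT; rewrite sum_by_rank.
have -> : ([set: 'I_n] == set0) = false.
  by rewrite -flat_rank0 ?flatT // rankST.
by move=> e; rewrite -[RHS]e; apply: eq_bigr => r _; apply: eq_bigl => G.
Qed.

(** Zaslavsky's theorem in the form chi(-1), the ambient dimension 4 being even. *)
Lemma cones_level : (#|cones a|)%:Z = \sum_(r < 5) level r setT * (-1) ^+ r.
Proof.
rewrite zaslavsky sum_by_rank; apply: eq_bigr => r _; rewrite mulr_suml.
by apply: eq_big => [G|G /andP[_ /eqP->]] //; rewrite subsetT andbT.
Qed.

End Moebius.

Lemma nat_mulrn (x m : nat) : x *+ m = (m * x)%N.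
Proof. by elim: m => // m IH; rewrite mulrS IH mulSn. Qed.

(** * Counting lines by weight *)

Section Counting.
Variables (R : realType) (n : nat) (a : 'I_n -> 'rV[R]_4).
Hypothesis arr : arrangement a.
Implicit Types S T F L G : {set 'I_n}.

Definition lines_in F (w : nat) : {set {set 'I_n}} :=
  [set L | [&& line a L, L \subset F & #|L| == w]].

Lemma lines_inT w : #|lines_in setT w| = h a w.
Proof. by apply: eq_card => L; rewrite !inE subsetT. Qed.

Lemma card_offdiag (A : {set 'I_n}) :
  (\sum_(p : 'I_n * 'I_n | [&& p.1 \in A, p.2 \in A & p.1 != p.2]) 1 = #|A| * #|A|.-1)%N.
Proof.
rewrite -(pair_big_dep (fun i => i \in A) (fun i j => (j \in A) && (i != j)) (fun _ _ => 1%N)) /=.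
rewrite (eq_bigr (fun=> #|A|.-1)) ?sum_nat_const // => i iA.
rewrite sum1_card (cardsD1 i A) iA /=; apply: eq_card => j.
by rewrite !inE /in_mem /= andbC eq_sym.
Qed.

(** Two distinct hyperplanes of a flat contain exactly one common line, so both sides count ordered
    pairs. *)
Lemma sum_line_pairs F : flat a F ->
  (\sum_(L | line a L && (L \subset F)) #|L| * #|L|.-1 = #|F| * #|F|.-1)%N.
Proof.
move=> fF; rewrite -[RHS]card_offdiag.
rewrite (partition_big (fun p => closure a [set p.1; p.2])
  (fun L => line a L && (L \subset F))) /=; last first.
  move=> [i j] /and3P[/= iF jF ij]; rewrite line_closure2 // closure_sub_flat //.
  by apply/subsetP => l /set2P[]->.
apply: eq_bigr => L /andP[lL LF]; rewrite -card_offdiag; apply: eq_bigl => -[i j] /=.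
apply/and3P/andP => [[iL jL ij]|[/and3P[iF jF ij] /eqP <-]].
  by rewrite !(subsetP LF) // ij (line_closure arr lL iL jL ij).
by split=> //; apply: (subsetP (sub_closure _ _)); rewrite !inE eqxx ?orbT.
Qed.

(* A hyperplane not containing a double line meets it in exactly one vertex. *)
Lemma sum_double_lines :
  (\sum_(F | flat a F && (rankS a F == 3%N)) #|lines_in F 2| * (#|F| - 2)
   = h a 2 * (n - 2))%N.
Proof.
have cnt F : (#|lines_in F 2| * (#|F| - 2) = \sum_(p : {set 'I_n} * 'I_n |
    [&& p.1 \in lines_in F 2, p.2 \in F & p.2 \notin p.1]) 1)%N.
  rewrite -(pair_big_dep (fun L => L \in lines_in F 2)
    (fun L j => (j \in F) && (j \notin L)) (fun _ _ => 1%N)) /=.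
  rewrite (eq_bigr (fun=> (#|F| - 2)%N)) ?sum_nat_const // => L.
  rewrite inE => /and3P[_ LF /eqP L2]; rewrite sum1_card -L2 -cardsDS //.
  by apply: eq_card => j; rewrite !inE /in_mem /= andbC.
rewrite -lines_inT -[X in (_ * (X - 2))%N](card_ord n) -cardsT (cnt setT).
rewrite (partition_big (fun p => closure a (p.2 |: p.1))
  (fun F => flat a F && (rankS a F == 3%N))) /=; last first.
  move=> [L k] /and3P[/=]; rewrite inE => /and3P[/andP[fL /eqP r2] _ _] _ kL.
  by rewrite flat_closure rankS_closure rankS_setU1 ?r2 // closure_flat.
apply: eq_bigr => F /andP[fF /eqP r3]; rewrite cnt; apply: eq_bigl => -[L k] /=.
rewrite !inE subsetT /=; apply/and3P/andP.
  move=> [/and3P[lL LF L2] kF kL]; rewrite lL L2 kL; split=> //; apply/eqP.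
  have /andP[fL /eqP r2] := lL.
  apply: closure_eq_rank => //; first by rewrite subUset sub1set kF.
  by rewrite rankS_setU1 ?r2 ?r3 // closure_flat.
move=> [/andP[/andP[lL L2] kL] /eqP <-]; rewrite kL L2 lL.
have /subsetP s := sub_closure a (k |: L).
split=> //; last by apply: s; rewrite setU11.
by rewrite andbT /=; apply/subsetP => i iL; apply: s; rewrite setU1r.
Qed.

Hypothesis weight_le3 : forall L, line a L -> (#|L| <= 3)%N.

Lemma sum_lines_in (M : nmodType) F (f : nat -> M) :
  \sum_(L | line a L && (L \subset F)) f #|L|
  = f 2%N *+ #|lines_in F 2| + f 3%N *+ #|lines_in F 3|.
Proof.
rewrite (bigID (fun L => #|L| == 2%N)) /=; congr (_ + _); rewrite -sumr_const.
  apply: eq_big => [L|L /andP[_ /eqP->]//]; by rewrite inE andbA.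
apply: eq_big => [L|L /andP[/andP[lL _]]].
  rewrite inE andbA; case: (boolP (line a L)) => //= lL; congr (_ && _).
  by have := line_card_gt1 arr lL; have := weight_le3 lL; case: #|L| => [|[|[|[|]]]].
by have := line_card_gt1 arr lL; have := weight_le3 lL; case: #|L| => [|[|[|[|]]]].
Qed.

Lemma card_flat_pairs F : flat a F ->
  (#|F| * #|F|.-1 = #|lines_in F 2| * 2 + #|lines_in F 3| * 6)%N.
Proof.
move=> fF; rewrite -sum_line_pairs //.
by have /= -> := sum_lines_in F (fun m => m * m.-1)%N; rewrite !nat_mulrn; lia.
Qed.

Lemma level2_lines F :
  level a 2 F = (#|lines_in F 2|)%:Z + 2 * (#|lines_in F 3|)%:Z.
Proof.
rewrite level2 //; have /= -> := sum_lines_in F (fun m => m%:Z - 1).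
by rewrite /= -[_ *+ #|lines_in F 3|]mulr_natr natz; congr (_ + _); rewrite natz.
Qed.

End Counting.

Lemma has_sign_scale (R : realType) (e u r : R) :
  0 < e -> 0 < u * r -> has_sign (0 < u) (e * r).
Proof.
move=> e0 ur; have [u0|u0|u0] := ltrgtP u 0; last by rewrite u0 mul0r ltxx in ur.
  by rewrite /has_sign pmulr_rlt0 // -(nmulr_rgt0 _ u0).
by rewrite /has_sign pmulr_rgt0 // -(pmulr_rgt0 _ u0).
Qed.

(** * Every line is the intersection of two walls of some chamber *)

Section SimplyLaced.
Variables (R : realType) (n : nat) (a : 'I_n -> 'rV[R]_4).
Hypothesis arr : arrangement a.
Implicit Types S T F L G : {set 'I_n}.

(** Induction over the remaining hyperplanes: if the point lies on H_j, a small step along a vector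
    dual to [a j] and orthogonal to [F] leaves H_j and keeps the nonzero values already obtained. *)
Lemma flat_generic_point F : flat a F -> exists x : 'cV[R]_4,
  (forall i, i \in F -> dotv a i x = 0) /\ (forall j, j \notin F -> dotv a j x != 0).
Proof.
move=> fF.
have gen (s : seq 'I_n) : (forall j, j \in s -> j \notin F) -> exists x : 'cV[R]_4,
    (forall i, i \in F -> dotv a i x = 0) /\ (forall j, j \in s -> dotv a j x != 0).
  elim: s => [|j s IH] sF.
    by exists 0; split=> // i _; rewrite /dotv mulmx0 mxE.
  have [|x [xF xs]] := IH; first by move=> i si; apply: sF; rewrite in_cons si orbT.
  have [jx|jx] := eqVneq (dotv a j x) 0; last first.
    by exists x; split=> // i; rewrite in_cons => /predU1P[->|/xs].
  have [|y [yF yj]] := @exists_dual _ _ a F j; first by rewrite closure_flat ?sF ?mem_head.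
  have [|e e0 He] := @realizes_near R n a [set i in s] [ffun i => 0 < dotv a i x] x y.
    by move=> i; rewrite inE ffunE => /xs/has_sign_gt0.
  exists (x + e *: y); split=> i; rewrite ?in_cons.
    by move=> iF; rewrite dotvD dotvZ xF // yF // mulr0 addr0.
  move=> /predU1P[->|si]; first by rewrite dotvD dotvZ jx yj mulr1 add0r gt_eqF.
  by have := He e; rewrite gtr0_norm // => /(_ (lexx _) i); rewrite inE => /(_ si)/has_sign_neq0.
have [|x [xF xs]] := gen (enum (~: F)); first by move=> j; rewrite mem_enum inE.
by exists x; split=> // j jF; apply: xs; rewrite mem_enum inE.
Qed.

(** Transversally to [L], its hyperplanes are lines through the origin of a plane. On a path that
    leaves H_k, the first one met is some H_k', and the sector in between is uncut. Near a generic
    point of [L] this sector belongs to a chamber with walls [k] and [k']. *)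
Lemma chamber_at_line L : line a L -> exists s k k',
  [/\ s \in cones a, k != k', k \in walls a s, k' \in walls a s & closure a [set k; k'] = L].
Proof.
move=> lL; have /andP[fL _] := lL.
have [k kL [j jL kj]] : exists2 k, k \in L & exists2 j, j \in L & k != j.
  by have /card_gt1P[k [j [kL jL kj]]] := line_card_gt1 arr lL; exists k => //; exists j.
have [|z [/(_ k (set11 k)) kz jz]] := @exists_dual _ _ a [set k] j.
  by rewrite closure1 // inE eq_sym.
have [|y0 [/(_ j (set11 j)) jy0 ky0]] := @exists_dual _ _ a [set j] k.
  by rewrite closure1 // inE.
(* The path [z + t *: y] starts on H_k and reaches H_j at t = 1, so some crossing time is
   positive. *)
pose y : 'cV[R]_4 := y0 - z.
have ky : dotv a k y = 1 by rewrite /y dotvD -scaleN1r dotvZ kz ky0 mulr0 addr0.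
have jy : dotv a j y = -1 by rewrite /y dotvD -scaleN1r dotvZ jz jy0 mulr1 add0r.
pose p i := dotv a i z; pose q i := dotv a i y.
have comb i l m : i \in L -> l \in L -> m \in L -> l != m ->
    exists al be, forall x, dotv a i x = al * dotv a l x + be * dotv a m x.
  move=> iL lL' mL lm; move: iL; rewrite -(line_closure arr lL lL' mL lm).
  by move=> /closureP/spanS2P[al [be e]]; exists al, be => x; apply: dotv_comb2.
have p0 i : i \in L -> i != k -> p i != 0.
  move=> iL ik; apply/eqP => pi; have [al [be e]] := comb j i k jL iL kL ik.
  have := e z; rewrite jz kz -/(p i) pi !mulr0 addr0 => /eqP.
  by rewrite oner_eq0.
(* [- p i / q i] is the time at which the path crosses H_i; when [q i = 0] the quotient is 0 and
   fails the positivity test. *)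
pose P i := [&& i \in L, i != k & 0 < - p i / q i].
have Pj : P j by rewrite /P jL eq_sym kj /p /q jz jy invrN1 mulrN1 opprK ltr01.
pose k' := [arg min_(i < j | P i) (- p i / q i)]%O.
have [Pk' min_k'] : P k' /\ forall i, P i -> - p k' / q k' <= - p i / q i.
  by rewrite /k'; case: arg_minP => // i Pi mi.
move/and3P: Pk' => [k'L k'k t1_gt0].
set t1 := - p k' / q k' in min_k' t1_gt0.
have g_near i t : i \in L -> i != k -> 0 <= t -> t <= t1 -> p i + t * q i != 0 ->
    0 < p i * (p i + t * q i).
  move=> iL ik t0 tt1 g0; have pi0 := p0 i iL ik.
  rewrite lt_neqAle eq_sym mulf_neq0 //=.
  have [pq|pq] := leP 0 (p i * q i); first by have := sqr_ge0 (p i); nra.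
  have q0 : q i != 0 by apply/eqP => q0; rewrite q0 mulr0 ltxx in pq.
  have rP : P i.
    rewrite /P iL ik /= -(pmulr_rgt0 _ (_ : 0 < q i ^+ 2)) ?exprn_even_gt0 //.
    by rewrite mulrCA expr2 mulrK ?unitfE // mulNr oppr_gt0.
  have := min_k' i rP; rewrite -/t1 => le1; have le2 := le_trans tt1 le1.
  have -> : p i * (p i + t * q i) = (p i * q i) * (t - (- p i / q i)) by field.
  by rewrite mulr_le0 ?(ltW pq) // subr_le0.
have q0' : q k' != 0 by apply/eqP => q0; rewrite /t1 q0 invr0 mulr0 ltxx in t1_gt0.
have gk' : p k' + t1 * q k' = 0 by rewrite /t1; field.
(* A point on two distinct hyperplanes of [L] lies on all of them, but [a k] takes the value
   [t1 > 0] at this point of the path. *)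
have g1 i : i \in L -> i != k -> i != k' -> p i + t1 * q i != 0.
  move=> iL ik ik'; apply/eqP => gi.
  have [al [be e]] := comb k i k' kL iL k'L ik'.
  have := e (z + t1 *: y); rewrite !dotvD !dotvZ -!/(p _) -!/(q _) gi gk' !mulr0 addr0.
  by rewrite /p /q kz ky mulr1 add0r => t10; rewrite t10 ltxx in t1_gt0.
have g_lt i t : i \in L -> i != k -> 0 <= t -> t < t1 -> p i + t * q i != 0.
  move=> iL ik t0 tt1; apply/eqP => gi; have pi0 := p0 i iL ik.
  have q0 : q i != 0 by apply/eqP => q0; rewrite q0 mulr0 addr0 in gi; rewrite gi eqxx in pi0.
  have te : t = - p i / q i by apply: (mulIf q0); rewrite divfK //; lra.
  have t_gt0 : 0 < t.
    rewrite lt_neqAle t0 andbT; apply/eqP => t00.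
    by rewrite -t00 mul0r addr0 in gi; rewrite gi eqxx in pi0.
  have /min_k' : P i by rewrite /P iL ik -te.
  by rewrite -te -/t1 leNgt tt1.
have [x0 [x0L x0N]] := flat_generic_point fL.
pose t2 := t1 / 2; have t20 : 0 < t2 by rewrite /t2; lra.
have t21 : t2 < t1 by rewrite /t2; lra.
pose s : {ffun 'I_n -> bool} :=
  [ffun i => if i \in L then 0 < dotv a i (z + t2 *: y) else 0 < dotv a i x0].
have nearw w : exists2 e, 0 < e & forall t : R, `|t| <= e -> realizes a (~: L) s (x0 + t *: w).
  apply: realizes_near => i; rewrite inE ffunE => /[dup] iL /negPf->.
  exact/has_sign_gt0/x0N.
(* The times 0, [t2] and [t1] give points of the wall [k], of the open chamber and of the wall [k'];
   one common small [e] preserves the signs off [L]. *)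
have [e0 e0_gt0 He0] := nearw z.
have [e1 e1_gt0 He1] := nearw (z + t2 *: y).
have [e2 e2_gt0 He2] := nearw (z + t1 *: y).
pose e := Num.min e0 (Num.min e1 e2).
have e_gt0 : 0 < e by rewrite !lt_min e0_gt0 e1_gt0.
have [ee0 ee1 ee2] : [/\ `|e| <= e0, `|e| <= e1 & `|e| <= e2].
  by rewrite gtr0_norm // !ge_min !lexx !orbT.
have dotL i t : i \in L -> dotv a i (x0 + e *: (z + t *: y)) = e * (p i + t * q i).
  by move=> iL; rewrite dotvD dotvZ x0L // add0r dotvD dotvZ.
have sL i : i \in L -> s i = (0 < p i + t2 * q i).
  by move=> iL; rewrite ffunE iL dotvD dotvZ.
have signL i t : i \in L -> i != k -> 0 <= t -> t <= t1 -> p i + t * q i != 0 ->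
    has_sign (s i) (e * (p i + t * q i)).
  move=> iL ik t0 tt1 g0; rewrite sL //; apply: has_sign_scale => //.
  have h1 := g_near i t iL ik t0 tt1 g0.
  have h2 := g_near i t2 iL ik (ltW t20) (ltW t21) (g_lt i t2 iL ik (ltW t20) t21).
  have h3 : 0 < p i ^+ 2 by rewrite exprn_even_gt0 //= p0.
  by rewrite -(pmulr_rgt0 _ h3); have := mulr_gt0 h1 h2; congr (0 < _); ring.
have sk t : 0 < t -> has_sign (s k) (e * (p k + t * q k)).
  move=> t0; rewrite sL //; apply: has_sign_scale => //.
  by rewrite /p /q kz ky !add0r !mulr1 mulr_gt0.
have real_w i w : has_sign (s i) (dotv a i w) -> if s i then 0 < dotv a i w else dotv a i w < 0.
  by rewrite /has_sign; case: (s i).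
exists s, k, k'; split.
- rewrite inE; apply/asboolP; exists (x0 + e *: (z + t2 *: y)) => i; apply: real_w.
  have [iL|iL] := boolP (i \in L); last by apply: He1; rewrite ?inE.
  rewrite dotL //; have [->|ik] := eqVneq i k; first exact: sk.
  by apply: signL; rewrite ?ltW // g_lt // ltW.
- by rewrite eq_sym.
- rewrite inE; apply/asboolP; exists (x0 + e *: (z + 0 *: y)); split.
    by rewrite dotL // mul0r addr0 /p kz mulr0.
  move=> i ik; apply: real_w; have [iL|iL] := boolP (i \in L).
    by rewrite dotL //; apply: signL; rewrite ?lexx ?ltW ?g_lt.
  by rewrite scale0r addr0; apply: He0; rewrite ?inE.
- rewrite inE; apply/asboolP; exists (x0 + e *: (z + t1 *: y)); split.
    by rewrite dotL // gk' mulr0.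
  move=> i ik'; apply: real_w; have [iL|iL] := boolP (i \in L); last by apply: He2; rewrite ?inE.
  rewrite dotL //; have [->|ik] := eqVneq i k; first exact: sk.
  by apply: signL; rewrite ?lexx ?ltW ?g1.
- by apply: line_closure; rewrite // eq_sym.
Qed.

Lemma simply_laced_weight L : simply_laced a -> line a L -> (#|L| <= 3)%N.
Proof.
move=> sl /chamber_at_line[s [k [k' [sC kk' ks k's <-]]]].
exact: sl sC _ _ kk' ks k's.
Qed.

End SimplyLaced.

(** * Affine line arrangements in the plane *)

Section PlaneLines.
Variables (R : realType) (I : finType) (D : {set I}) (s d : I -> R).

(* Affine lines y = s i * x + d i: if every line has a parallel companion, then
   the crossing with the largest abscissa is a simple one, because a parallel to
   the middle one of three concurrent lines meets an outer one further right. *)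
Lemma rightmost_crossing :
  (forall i j, i \in D -> j \in D -> s i = s j -> d i = d j -> i = j) ->
  (forall i, i \in D -> exists2 j, j \in D & j != i /\ s j = s i) ->
  (exists i j, [/\ i \in D, j \in D & s i != s j]) ->
  exists i j x y, [/\ i \in D, j \in D, s i != s j,
    y = s i * x + d i /\ y = s j * x + d j &
    (forall l, l \in D -> y = s l * x + d l -> l = i \/ l = j) /\
    (forall l l' x', l \in D -> l' \in D -> s l != s l' ->
       s l * x' + d l = s l' * x' + d l' -> x' <= x)].
Proof.
move=> inj par [i0 [j0 [i0D j0D sij0]]].
pose P (p : I * I) := [&& p.1 \in D, p.2 \in D & s p.1 != s p.2].
pose X (p : I * I) := (d p.2 - d p.1) / (s p.1 - s p.2).
have P0 : P (i0, j0) by rewrite /P i0D j0D.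
case: (@arg_maxP _ _ _ (i0, j0) P X P0) => -[i j] /and3P[/= iD jD sij] maxX.
set x := X (i, j) in maxX.
have crossE l l' x' : s l != s l' -> s l * x' + d l = s l' * x' + d l' -> x' = X (l, l').
  rewrite -subr_eq0 => sl e; apply: (mulIf sl); rewrite /X /= divfK //.
  by rewrite mulrBr; lra.
have max l l' x' : l \in D -> l' \in D -> s l != s l' ->
    s l * x' + d l = s l' * x' + d l' -> x' <= x.
  move=> lD l'D sl /(crossE _ _ _ sl) ->; apply: maxX; by rewrite /P lD l'D.
(* A parallel [g] below the middle line [l2] meets [l1] to the right of [x]; a parallel above it
   meets [l3] there. *)
have no3 l1 l2 l3 y : l1 \in D -> l2 \in D -> l3 \in D ->
    y = s l1 * x + d l1 -> y = s l2 * x + d l2 -> y = s l3 * x + d l3 ->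
    s l1 < s l2 -> s l2 < s l3 -> False.
  move=> l1D l2D l3D y1 y2 y3 s12 s23.
  have [g gD [gl2 sg]] := par l2 l2D.
  have dg : d g != d l2 by apply: contra gl2 => /eqP dg; apply/eqP/inj.
  have [dlt|dlt|de] := ltgtP (d g) (d l2); last by rewrite de eqxx in dg.
    have s21 : 0 < s l2 - s l1 by lra.
    have := max l1 g (x + (d l2 - d g) / (s l2 - s l1)) l1D gD.
    have h0 : 0 < (d l2 - d g) / (s l2 - s l1) by apply: divr_gt0; lra.
    rewrite sg lt_eqF // => /(_ isT) H.
    suff : x + (d l2 - d g) / (s l2 - s l1) <= x by lra.
    apply: H.
    have : (d l2 - d g) / (s l2 - s l1) * (s l2 - s l1) = d l2 - d g by rewrite divfK // gt_eqF.
    by move: ((d l2 - d g) / (s l2 - s l1)) => t tE; lra.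
  have s32 : 0 < s l3 - s l2 by lra.
  have := max l3 g (x + (d g - d l2) / (s l3 - s l2)) l3D gD.
  have h0 : 0 < (d g - d l2) / (s l3 - s l2) by apply: divr_gt0; lra.
  rewrite sg gt_eqF // => /(_ isT) H.
  suff : x + (d g - d l2) / (s l3 - s l2) <= x by lra.
  apply: H.
  have : (d g - d l2) / (s l3 - s l2) * (s l3 - s l2) = d g - d l2 by rewrite divfK // gt_eqF.
  by move: ((d g - d l2) / (s l3 - s l2)) => t tE; lra.
have cross : s i * x + d i = s j * x + d j.
  have : x * (s i - s j) = d j - d i by rewrite /x /X /= divfK // subr_eq0.
  by rewrite mulrBr; lra.
exists i, j, x, (s i * x + d i); split=> //; split=> // l lD le.
have neq_s l' : l' \in D -> s i * x + d i = s l' * x + d l' -> l = l' \/ s l != s l'.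
  move=> l'D l'e; have [sl|] := eqVneq (s l) (s l'); last by right.
  by left; apply: inj => //; rewrite sl in le; lra.
have [|sli] := neq_s i iD erefl; first by left.
have [|slj] := neq_s j jD cross; first by right.
exfalso.
(* Otherwise three distinct slopes occur at the point; each consistent order is an instance of
   [no3], and the two cyclic ones are absurd. *)
case: (ltgtP (s l) (s i)) sli => // li _; case: (ltgtP (s l) (s j)) slj => // lj _;
  case: (ltgtP (s i) (s j)) sij => // ij _.
- exact: (no3 l i j _ lD iD jD le erefl cross).
- exact: (no3 l j i _ lD jD iD le cross erefl).
- by have := lt_trans li ij; rewrite ltNge (ltW lj).
- exact: (no3 j l i _ jD lD iD cross le erefl).
- exact: (no3 i l j _ iD lD jD erefl le cross).
- by have := lt_trans ij li; rewrite ltNge (ltW lj).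
- exact: (no3 i j l _ iD jD lD erefl cross le).
- exact: (no3 j i l _ jD iD lD cross erefl le).
Qed.

End PlaneLines.

(** * Double points of the projective line arrangement around a vertex [F] *)

Section Local.
Variables (R : realType) (n : nat) (a : 'I_n -> 'rV[R]_4).
Hypothesis arr : arrangement a.
Variable F : {set 'I_n}.
Hypotheses (fF : flat a F) (rF : rankS a F = 3%N).

(* In the projective plane cut out by F, the lines q1, q2 and k bound a triangle
   that no line of F enters: its sides run from the vertex p along u1 and u2. *)
Definition attached q1 q2 k : Prop := exists p u1 u2 : 'cV[R]_4,
  [/\ [/\ dotv a q1 p = 0, dotv a q2 p = 0 & dotv a k p != 0],
      [/\ dotv a k u1 = 0, dotv a q1 u1 = 0 & dotv a q2 u1 != 0],
      [/\ dotv a k u2 = 0, dotv a q2 u2 = 0 & dotv a q1 u2 != 0] &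
      forall g, g \in F -> 0 <= dotv a g p * dotv a g u1 /\ 0 <= dotv a g p * dotv a g u2].

Lemma proportional_eq i j c : a i = c *: a j -> i = j.
Proof.
move=> e; apply/eqP/negP => /negP ij; have := rankS_set2 arr ij.
suff : (rankS a [set i; j] <= rankS a [set j])%N by rewrite rankS_set1 // => + r2; rewrite r2.
rewrite -(rankS_closure a [set j]); apply: rankS_mono.
apply/subsetP => l /set2P[]->; last by rewrite (subsetP (sub_closure _ _)) ?set11.
by apply/closureP; rewrite spanS1 e scalemx_sub.
Qed.

Lemma flat3_comb i j k : i \in F -> j \in F -> i != j -> k \in F ->
  k \notin closure a [set i; j] ->
  forall g, g \in F -> exists al be ga, a g = al *: a i + be *: a j + ga *: a k.
Proof.
move=> iF jF ij kF kij g gF.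
have : closure a (k |: [set i; j]) = F.
  apply: closure_eq_rank => //; last by rewrite rankS_setU1 // rankS_set2.
  by apply/subsetP => l /setU1P[->//|/set2P[]->].
move/setP/(_ g); rewrite gF => /closureP/spanS3P[ga [al [be ->]]].
by exists al, be, ga; rewrite -addrA addrC.
Qed.

(** Without double points, [k] becomes the line at infinity of the chart [e3 + x *: e1 + y *: w].
    Every other [g] is the graph y = s g * x + d g, lines that meet on [k] are parallel, and
    [rightmost_crossing] yields the vertex opposite to [k]. *)
Lemma attached_or_double k : k \in F ->
  (exists2 L, L \in lines_in a F 2 & k \in L) \/
  (exists q1 q2, [/\ q1 != q2, [set q1; q2] \in lines_in a F 2,
     k \notin [set q1; q2] & attached q1 q2 k]).
Proof.
move=> kF; have [[L]|nodouble] := pselect (exists2 L, L \in lines_in a F 2 & k \in L).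
  by left; exists L.
right; have fk : flat a [set k] by rewrite /flat closure1.
(* The vertical direction [w] lies on H_k and on no other hyperplane, so no affine line is
   vertical. *)
have [w [/(_ k (set11 k)) kw wN]] := flat_generic_point fk.
have w0 g : g != k -> dotv a g w != 0 by move=> gk; apply: wN; rewrite inE.
have [i0 i0F i0k] : exists2 i, i \in F & i != k.
  have : ~~ (F \subset [set k]).
    by apply/negP => /(rankS_mono a); rewrite rF rankS_set1.
  by move=> /subsetPn[i iF]; rewrite inE; exists i.
have [j0 j0F j0N] : exists2 j, j \in F & j \notin closure a [set k; i0].
  apply/subsetPn/negP => /(rankS_mono a).
  by rewrite rF rankS_closure rankS_set2 // eq_sym.
have ki0 : k != i0 by rewrite eq_sym.
have [e1 [e1z j0e1]] := exists_dual j0N.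
have ke1 : dotv a k e1 = 0 by apply: e1z; rewrite !inE eqxx.
have i0e1 : dotv a i0 e1 = 0 by apply: e1z; rewrite !inE eqxx orbT.
have [e3 ke3] := rv_neq0_dual (normal_neq0 arr k); rewrite -/(dotv a k e3) in ke3.
have j0k : j0 != k.
  by apply: contraNneq j0N => ->; rewrite (subsetP (sub_closure _ _)) // !inE eqxx.
pose D := F :\ k.
pose s g := - dotv a g e1 / dotv a g w; pose d g := - dotv a g e3 / dotv a g w.
have sE g : g != k -> dotv a g e1 = - s g * dotv a g w.
  by move=> /w0 gw; rewrite /s; field.
have dE g : g != k -> dotv a g e3 = - d g * dotv a g w.
  by move=> /w0 gw; rewrite /d; field.
have combF := flat3_comb kF i0F ki0 j0F j0N.
(* Equal slopes and intercepts make the values on [e1], [w] and [e3] proportional, hence also the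
   coordinates with respect to [a k], [a i0], [a j0]. *)
have inj i j : i \in D -> j \in D -> s i = s j -> d i = d j -> i = j.
  move=> /setD1P[ik iF] /setD1P[jk jF] sij dij.
  have [x1 [x2 [x3 ei]]] := combF i iF; have [y1 [y2 [y3 ej]]] := combF j jF.
  have iv x := dotv_comb3 x ei; have jv x := dotv_comb3 x ej.
  have ww := w0 j jk; have i0w := w0 i0 i0k.
  pose c := dotv a i w / dotv a j w.
  have cE : dotv a i w = c * dotv a j w by rewrite /c divfK.
  have ce1 : dotv a i e1 = c * dotv a j e1 by rewrite (sE i) // (sE j) // sij cE; ring.
  have ce3 : dotv a i e3 = c * dotv a j e3 by rewrite (dE i) // (dE j) // dij cE; ring.
  have x3E : x3 = c * y3.
    by move: ce1; rewrite iv jv ke1 i0e1 j0e1 !mulr0 !addr0 !add0r !mulr1.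
  have x2E : x2 = c * y2.
    move: cE; rewrite iv jv kw !mulr0 !add0r x3E => e.
    by apply: (mulIf i0w); lra.
  have x1E : x1 = c * y1.
    by move: ce3; rewrite iv jv ke3 x2E x3E !mulr1; lra.
  by apply: (@proportional_eq i j c); rewrite ei ej x1E x2E x3E !scalerDr !scalerA.
(* The line through [k] and [i] is not double, so it has a third member [j]. Its normal is a
   multiple of [a i] plus a multiple of [a k], and [a k] vanishes on [e1] and [w]. *)
have par i : i \in D -> exists2 j, j \in D & j != i /\ s j = s i.
  move=> /setD1P[ik iF]; have ki : k != i by rewrite eq_sym.
  pose L := closure a [set k; i].
  have lL : line a L by apply: line_closure2.
  have LF : L \subset F.
    by rewrite closure_sub_flat //; apply/subsetP => l /set2P[]->.
  have [kL iL] : k \in L /\ i \in L.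
    by split; rewrite (subsetP (sub_closure _ _)) // !inE eqxx ?orbT.
  have : ~~ (L \subset [set k; i]).
    apply/negP => Lki; apply: nodouble; exists L => //; rewrite inE lL LF /=.
    by rewrite eqn_leq (line_card_gt1 arr lL) andbT (leq_trans (subset_leq_card Lki)) // cards2 ki.
  move=> /subsetPn[j jL]; rewrite !inE negb_or => /andP[jk ji].
  exists j; first by rewrite !inE jk (subsetP LF).
  split=> //; have /closureP/spanS2P[al [be e]] := jL.
  have jv x := dotv_comb2 x e; have := w0 j jk.
  rewrite /s !jv ke1 kw !mulr0 !add0r mulf_eq0 negb_or => /andP[be0 iw].
  by field; rewrite be0 iw.
have [|i [j [x [y [/setD1P[ik iF] /setD1P[jk jF] sij [yi yj] [only maxx]]]]]] :=
    rightmost_crossing inj par.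
  exists i0, j0; rewrite !inE i0k j0k i0F j0F; split=> //.
  by rewrite /s i0e1 j0e1 oppr0 mul0r mulN1r eq_sym oppr_eq0 invr_eq0 w0.
pose p := e3 + x *: e1 + y *: w.
have pE g : g != k -> dotv a g p = (y - s g * x - d g) * dotv a g w.
  by move=> gk; rewrite /p !dotvD !dotvZ sE // dE //; ring.
have kp : dotv a k p = 1 by rewrite /p !dotvD !dotvZ ke3 ke1 kw; ring.
have ip : dotv a i p = 0 by rewrite pE // yi; ring.
have jp : dotv a j p = 0 by rewrite pE // yj; ring.
have ij : i != j by apply: contraNneq sij => ->.
pose L := closure a [set i; j].
have LE : L = [set i; j].
  apply/eqP; rewrite eqEsubset sub_closure andbT; apply/subsetP => g gL.
  have gF : g \in F.
    by apply: subsetP gL; rewrite closure_sub_flat //; apply/subsetP => l /set2P[]->.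
  have /closureP/spanS2P[al [be e]] := gL.
  have gp : dotv a g p = 0 by rewrite (dotv_comb2 p e) ip jp !mulr0 addr0.
  have gk : g != k by apply/eqP => gk; move/eqP: kp; rewrite -gk gp eq_sym oner_eq0.
  have gD : g \in D by rewrite !inE gk.
  rewrite !inE; have [|->|->] := only g gD; rewrite ?eqxx ?orbT //.
  move/eqP: gp; rewrite pE // mulf_eq0 (negPf (w0 g gk)) orbF => /eqP; lra.
have lL : line a [set i; j] by rewrite -LE; apply: line_closure2.
(* [u g] is the direction of the affine line [g], that is, its point at infinity on [k]. *)
pose u g := e1 + s g *: w.
have uE g l : g != k -> dotv a g (u l) = (s l - s g) * dotv a g w.
  by move=> gk; rewrite /u dotvD dotvZ sE //; ring.
have ku l : dotv a k (u l) = 0 by rewrite /u dotvD dotvZ ke1 kw; ring.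
(* Moving right from [p] along [l] meets no further crossing, so no [g] separates [p] from [u l]. *)
have along l g : l \in D -> y = s l * x + d l -> g \in F -> 0 <= dotv a g p * dotv a g (u l).
  move=> lD yl gF; have [->|gk] := eqVneq g k; first by rewrite ku mulr0.
  have gD : g \in D by rewrite !inE gk.
  have [sl|sl] := eqVneq (s l) (s g); first by rewrite uE // sl subrr mul0r mulr0.
  rewrite pE // uE // mulrACA -expr2 mulr_ge0 ?sqr_ge0 //.
  have sl' : s l - s g != 0 by rewrite subr_eq0.
  have := maxx l g (x - (y - s g * x - d g) / (s l - s g)) lD gD sl.
  have tE : (y - s g * x - d g) / (s l - s g) * (s l - s g) = y - s g * x - d g by rewrite divfK.
  move: ((y - s g * x - d g) / (s l - s g)) tE => t tE H.
  have t0 : 0 <= t by (have : x - t <= x by apply: H; lra); lra.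
  rewrite -tE -mulrA -expr2 mulr_ge0 ?sqr_ge0 //.
exists i, j; split=> //.
- rewrite inE lL cards2 ij /= andbT; by apply/subsetP => l /set2P[]->.
- by rewrite !inE negb_or ![k == _]eq_sym ik.
exists p, (u i), (u j); split; first by rewrite ip jp kp oner_eq0.
- by rewrite ku !uE // subrr mul0r mulf_neq0 ?w0 // subr_eq0.
- by rewrite ku !uE // subrr mul0r mulf_neq0 ?w0 // subr_eq0 eq_sym.
move=> g gF; split; apply: along => //; by rewrite !inE ?ik ?jk.
Qed.


(* The reference point p0 orients the vertex q1 /\ q2, so that b1 and b2 select one
   of the four sectors around it. *)
Definition attached_in q1 q2 p0 b1 b2 k : Prop := exists p u1 u2 : 'cV[R]_4,
  [/\ [/\ dotv a q1 p = 0, dotv a q2 p = 0 & 0 < dotv a k p * dotv a k p0],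
      [/\ dotv a k u1 = 0, dotv a q1 u1 = 0 & has_sign b1 (dotv a q2 u1)],
      [/\ dotv a k u2 = 0, dotv a q2 u2 = 0 & has_sign b2 (dotv a q1 u2)] &
      forall g, g \in F -> 0 <= dotv a g p * dotv a g u1 /\ 0 <= dotv a g p * dotv a g u2].

(** Negating [p], [u1] and [u2] together preserves [attached]. This puts [p] on the side of H_k that
    contains [p0], and the two remaining signs name the sector. *)
Lemma attached_sector q1 q2 p0 k : attached q1 q2 k -> dotv a k p0 != 0 ->
  exists b1 b2, attached_in q1 q2 p0 b1 b2 k.
Proof.
move=> [p [u1 [u2 [[p1 p2 kp] [ku1 q1u1 q2u1] [ku2 q2u2 q1u2] pos]]]] kp0.
have [c [c2 ckp]] : exists c : R, c ^+ 2 = 1 /\ 0 < c * (dotv a k p * dotv a k p0).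
  have [lt0|gt0|e0] := ltgtP (dotv a k p * dotv a k p0) 0.
  - by exists (-1); rewrite sqrrN expr1n mulN1r oppr_gt0.
  - by exists 1; rewrite expr1n mul1r.
  by move/eqP: e0; rewrite mulf_eq0 (negPf kp) (negPf kp0).
have c0 : c != 0 by apply/eqP => c0; rewrite c0 mul0r ltxx in ckp.
exists (0 < c * dotv a q2 u1), (0 < c * dotv a q1 u2), (c *: p), (c *: u1), (c *: u2).
rewrite !dotvZ p1 p2 ku1 q1u1 ku2 q2u2 !mulr0 -mulrA; split=> //.
- by split=> //; apply/has_sign_gt0/mulf_neq0.
- by split=> //; apply/has_sign_gt0/mulf_neq0.
move=> g gF; have [h1 h2] := pos g gF.
by rewrite !dotvZ ![(c * _) * (c * _)]mulrACA -expr2 c2 !mul1r.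
Qed.

(** Expand [a k'] in [a q1], [a q2], [a k]. Since [k'] does not enter the triangle of [k], nor [k]
    that of [k'], and both triangles lie in one sector, the coefficients of [a q1] and [a q2] get
    opposite weak signs and vanish. *)
Lemma attached_in_inj q1 q2 p0 b1 b2 k k' :
  q1 \in F -> q2 \in F -> q1 != q2 -> k \in F -> k' \in F ->
  k \notin closure a [set q1; q2] -> dotv a q1 p0 = 0 -> dotv a q2 p0 = 0 ->
  attached_in q1 q2 p0 b1 b2 k -> attached_in q1 q2 p0 b1 b2 k' -> k = k'.
Proof.
move=> q1F q2F q12 kF k'F kN q1p0 q2p0.
move=> [p [u1 [u2 [[p1 p2 kp] [ku1 q1u1 q2u1] [ku2 q2u2 q1u2] pos]]]].
move=> [p' [u1' [u2' [[p1' p2' kp'] [ku1' q1u1' q2u1'] [ku2' q2u2' q1u2'] pos']]]].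
have [al [be [ga e]]] := flat3_comb q1F q2F q12 kF kN k'F.
have ev x := dotv_comb3 x e.
have sgn b (r r' : R) : has_sign b r -> has_sign b r' -> 0 < r * r'.
  by case: b => /= r0 r'0; nra.
have zero (b X Y : R) : 0 < X * Y -> 0 <= b * X -> b * Y <= 0 -> b = 0.
  move=> XY bX bY; apply/eqP; rewrite -sqrf_eq0 -(mulIr_eq0 _ (mulIf (lt0r_neq0 XY))).
  rewrite eq_le; apply/andP; split; last by rewrite mulr_ge0 ?sqr_ge0 ?ltW.
  have -> : b ^+ 2 * (X * Y) = (b * X) * (b * Y) by ring.
  exact: mulr_ge0_le0.
have k'p0 : dotv a k' p0 = ga * dotv a k p0 by rewrite ev q1p0 q2p0; ring.
have k'p : dotv a k' p = ga * dotv a k p by rewrite ev p1 p2; ring.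
have k'p' : dotv a k' p' = ga * dotv a k p' by rewrite ev p1' p2'; ring.
have k'u1 : dotv a k' u1 = be * dotv a q2 u1 by rewrite ev ku1 q1u1; ring.
have k'u2 : dotv a k' u2 = al * dotv a q1 u2 by rewrite ev ku2 q2u2; ring.
have ku1'E : be * dotv a q2 u1' + ga * dotv a k u1' = 0 by rewrite -ku1' ev q1u1'; ring.
have ku2'E : al * dotv a q1 u2' + ga * dotv a k u2' = 0 by rewrite -ku2' ev q2u2'; ring.
have [c1 c2] := pos k' k'F; have [c1' c2'] := pos' k kF.
rewrite k'p k'u1 in c1; rewrite k'p k'u2 in c2.
have hp : 0 < (ga * dotv a k p) * dotv a k' p'.
  suff h : 0 < ((ga * dotv a k p) * dotv a k' p') * (dotv a k p0) ^+ 2.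
    by move: h; rewrite pmulr_lgt0 // exprn_even_gt0 //=; apply/eqP => z; rewrite z mulr0 ltxx in kp.
  have := mulr_gt0 kp kp'; rewrite k'p0; congr (0 < _); ring.
have le0 (c r t : R) : c * r + ga * t = 0 -> 0 <= dotv a k p' * t -> c * (dotv a k' p' * r) <= 0.
  move=> e0 le; have -> : c * (dotv a k' p' * r) = - (ga ^+ 2 * (dotv a k p' * t)).
    rewrite k'p'; have -> : c * (ga * dotv a k p' * r) = ga * dotv a k p' * (c * r) by ring.
    have -> : c * r = - (ga * t) by lra.
    by ring.
  by rewrite oppr_le0 mulr_ge0 ?sqr_ge0.
have be0 : be = 0.
  apply: (zero _ (ga * dotv a k p * dotv a q2 u1) (dotv a k' p' * dotv a q2 u1')).
  - by rewrite mulrACA mulr_gt0 // (sgn b1).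
  - by rewrite mulrCA.
  - exact: (le0 _ _ _ ku1'E).
have al0 : al = 0.
  apply: (zero _ (ga * dotv a k p * dotv a q1 u2) (dotv a k' p' * dotv a q1 u2')).
  - by rewrite mulrACA mulr_gt0 // (sgn b2).
  - by rewrite mulrCA.
  - exact: (le0 _ _ _ ku2'E).
by apply/esym/(@proportional_eq k' k ga); rewrite e al0 be0 !scale0r !add0r.
Qed.

(** The two signs of [attached_in] distinguish four sectors, and [attached_in_inj] allows one line
    in each. *)
Lemma card_attached_le4 q1 q2 : q1 != q2 -> [set q1; q2] \in lines_in a F 2 ->
  (#|[set k in F | (k \notin [set q1; q2]) && `[< attached q1 q2 k >]]| <= 4)%N.
Proof.
move=> q12; rewrite inE => /and3P[/andP[fL _] LF _].
have [q1F q2F] : q1 \in F /\ q2 \in F.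
  by split; apply: (subsetP LF); rewrite !inE eqxx ?orbT.
have [K0|[k0]] := set_0Vmem [set k in F | (k \notin [set q1; q2]) && `[< attached q1 q2 k >]].
  by rewrite K0 cards0.
rewrite inE => /and3P[k0F k0N _].
have clL := closure_flat fL.
(* [p0] represents the double point; as [F] has rank 3, no line of [F] other than [q1] and [q2]
   passes through it. *)
have [|p0 [p0L k0p0]] := @exists_dual _ _ a [set q1; q2] k0; first by rewrite clL.
have q1p0 : dotv a q1 p0 = 0 by apply: p0L; rewrite !inE eqxx.
have q2p0 : dotv a q2 p0 = 0 by apply: p0L; rewrite !inE eqxx orbT.
have kp0 k : k \in F -> k \notin [set q1; q2] -> dotv a k p0 != 0.
  move=> kF kN; have [|al [be [ga e]]] := flat3_comb q1F q2F q12 kF _ k0F; first by rewrite clL.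
  apply/eqP => kp; have := dotv_comb3 p0 e; rewrite k0p0 q1p0 q2p0 kp !mulr0 !addr0 => /eqP.
  by rewrite oner_eq0.
pose A (b : bool * bool) := [set k in F | (k \notin [set q1; q2]) &&
  `[< attached_in q1 q2 p0 b.1 b.2 k >]].
have A1 b : (#|A b| <= 1)%N.
  apply/card_le1_eqP => k k'; rewrite in_set => /and3P[kF kN /asboolP ak].
  rewrite in_set => /and3P[k'F _ /asboolP ak'].
  by apply: esym (attached_in_inj q1F q2F q12 kF k'F _ q1p0 q2p0 ak ak'); rewrite clL.
apply: leq_trans (_ : #|\bigcup_b A b| <= 4)%N.
  apply/subset_leq_card/subsetP => k; rewrite inE => /and3P[kF kN /asboolP ak].
  have [b1 [b2 akb]] := attached_sector ak (kp0 k kF kN).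
  by apply/bigcupP; exists (b1, b2) => //; rewrite inE kF kN; apply/asboolP.
apply: leq_trans (_ : \sum_b #|A b| <= 4)%N.
  elim/big_rec2: _ => [|b m B _ IH]; first by rewrite cards0.
  by rewrite (leq_trans (leq_card_setU _ _)) // leq_add2l.
apply: leq_trans (_ : \sum_(b : bool * bool) 1 <= 4)%N; first exact: leq_sum.
by rewrite sum1_card card_prod card_bool.
Qed.

(** Each line of [F] is charged to a double point that lies on it or to which it is attached; a
    double point receives at most 2 + 4 lines. *)
Lemma double_lines_lower_bound : (#|F| <= 6 * #|lines_in a F 2|)%N.
Proof.
pose near L := L :|: [set k in F | (k \notin L) &&
  [exists q1, exists q2, [&& q1 != q2, L == [set q1; q2] & `[< attached q1 q2 k >]]]].
have cover : F \subset \bigcup_(L in lines_in a F 2) near L.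
  apply/subsetP => k kF; apply/bigcupP.
  have [[L LF kL]|[q1 [q2 [q12 LF kN ak]]]] := attached_or_double kF.
    by exists L => //; rewrite inE kL.
  exists [set q1; q2] => //; apply/setUP; right; rewrite inE kF kN /=.
  by apply/existsP; exists q1; apply/existsP; exists q2; rewrite q12 eqxx; apply/asboolP.
apply: leq_trans (subset_leq_card cover) _.
apply: leq_trans (_ : \sum_(L in lines_in a F 2) #|near L| <= _)%N.
  elim/big_rec2: _ => [|b m B _ IH]; first by rewrite cards0.
  by rewrite (leq_trans (leq_card_setU _ _)) // leq_add2l.
rewrite mulnC -sum_nat_const; apply: leq_sum => L LF.
have : #|L| == 2%N by move: LF; rewrite inE => /and3P[].
move=> /[dup] L2 /cards2P[q1 [q2 [q12 LE]]].
rewrite (leq_trans (leq_card_setU _ _)) // (eqP L2) -[6%N]/(2 + 4)%N leq_add2l.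
subst L; apply: leq_trans (card_attached_le4 q12 LF).
apply/subset_leq_card/subsetP => k; rewrite !in_set => /and3P[-> -> /=].
move=> /existsP[r1 /existsP[r2 /and3P[r12 /eqP rE /asboolP ak]]]; apply/asboolP.
(* The double point may be named in either order; exchanging [u1] and [u2] shows that [attached] is
   symmetric in its first two arguments. *)
have := set21 r1 r2; have := set22 r1 r2; rewrite -rE !inE.
case/orP=> /eqP r2E; case/orP=> /eqP r1E; rewrite r1E r2E ?eqxx // in r12 ak *.
have [p [u1 [u2 [[p1 p2 kp] c1 c2 pos]]]] := ak.
by exists p, u2, u1; split=> // g /pos[].
Qed.

End Local.

(** * Inequalities for cubics with three real roots *)

Section Cubic.
Variables (R : rcfType) (x1 x2 x3 : R).
Let e1 := x1 + x2 + x3.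
Let e2 := x1 * x2 + x1 * x3 + x2 * x3.
Let e3 := x1 * x2 * x3.

Lemma cubic_e1_sqr : 3 * e2 <= e1 ^+ 2.
Proof.
rewrite -subr_ge0; have -> : e1 ^+ 2 - 3 * e2 =
  ((x1 - x2) ^+ 2 + (x1 - x3) ^+ 2 + (x2 - x3) ^+ 2) / 2 by rewrite /e1 /e2; field.
by rewrite divr_ge0 ?addr_ge0 ?sqr_ge0.
Qed.

Lemma cubic_e2_sqr : 3 * e1 * e3 <= e2 ^+ 2.
Proof.
rewrite -subr_ge0; have -> : e2 ^+ 2 - 3 * e1 * e3 = ((x1 * x2 - x1 * x3) ^+ 2
  + (x1 * x2 - x2 * x3) ^+ 2 + (x1 * x3 - x2 * x3) ^+ 2) / 2 by rewrite /e1 /e2 /e3; field.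
by rewrite divr_ge0 ?addr_ge0 ?sqr_ge0.
Qed.

(** Combines 3 e1 e3 <= e2^2 with 9 e2^2 <= e1^4. Individual [x1], [x2], [x3] may be negative, so
    the inequality of arithmetic and geometric means does not apply directly. *)
Lemma cubic_e3_upper : 0 < e1 -> 0 <= e2 -> e3 <= e1 ^+ 3 / 27.
Proof.
move=> e1_gt0 e2_ge0; have h1 := cubic_e1_sqr; have h2 := cubic_e2_sqr.
have h3 : 9 * e2 ^+ 2 <= e1 ^+ 4.
  have -> : 9 * e2 ^+ 2 = (3 * e2) ^+ 2 by ring.
  have -> : e1 ^+ 4 = (e1 ^+ 2) ^+ 2 by ring.
  by rewrite ler_pXn2r // ?nnegrE ?sqr_ge0 ?mulr_ge0.
rewrite ler_pdivlMr // -(ler_pM2l e1_gt0) -exprS.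
have -> : e1 * (e3 * 27) = 9 * (3 * e1 * e3) by ring.
by apply: le_trans h3; rewrite ler_pM2l.
Qed.

(* Nonnegativity of the discriminant [27 ((x1-x2)(x1-x3)(x2-x3))^2 = 4 D^3 - Q^2],
   where D = e1^2 - 3 e2 and Q = 27 e3 - 9 e1 e2 + 2 e1^3. *)
Lemma cubic_e3_lower :
  e1 ^+ 3 - 3 * e1 * (e1 ^+ 2 - 3 * e2) - 2 * Num.sqrt ((e1 ^+ 2 - 3 * e2) ^+ 3) <= 27 * e3.
Proof.
have h1 := cubic_e1_sqr; set D := e1 ^+ 2 - 3 * e2.
pose Q := 27 * e3 - 9 * e1 * e2 + 2 * e1 ^+ 3.
have QD : Q ^+ 2 <= 4 * D ^+ 3.
  rewrite -subr_ge0; have -> : 4 * D ^+ 3 - Q ^+ 2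
    = 27 * ((x1 - x2) * (x1 - x3) * (x2 - x3)) ^+ 2 by rewrite /D /Q /e1 /e2 /e3; ring.
  by rewrite mulr_ge0 ?sqr_ge0.
have D0 : 0 <= D ^+ 3 by rewrite exprn_ge0 // subr_ge0.
have : `|Q| <= 2 * Num.sqrt (D ^+ 3).
  rewrite -(ler_pXn2r (n := 2)) // ?nnegrE ?mulr_ge0 ?sqrtr_ge0 // real_normK ?num_real //.
  by rewrite exprMn sqr_sqrtr // -natrX.
rewrite ler_norml => /andP[+ _].
suff : e1 ^+ 3 - 3 * e1 * D = 27 * e3 - Q by lra.
by rewrite /D /Q; ring.
Qed.

End Cubic.

(** * From the coefficients of chi to the bounds of the theorem *)

Section Main.
Variables (R : realType) (n : nat) (a : 'I_n -> 'rV[R]_4).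
Hypotheses (arr : arrangement a) (sl : simply_laced a) (rr : chi_real_rooted a).

Local Notation B r := (level a r setT).

Lemma n_ge4 : (4 <= n)%N.
Proof. by have [_ _ r4] := arr; have := rank_leq_row (\matrix_(i < n) a i); rewrite r4. Qed.

(** Subtracting chi(1) = 0 from chi(-1) gives twice this value, so the halving in [f3] is exact.
    [B 3] is the signed coefficient -b3. *)
Lemma f3_level : (f3 a)%:Z = n%:Z - B 3.
Proof.
have := cones_level arr; have := sum_level arr.
rewrite !big_ord_recr !big_ord0 /= !level0 // !level1 // cardsT card_ord.
have -> : (-1) ^+ 2 = 1 :> int by [].
have -> : (-1) ^+ 3 = -1 :> int by [].
have -> : (-1) ^+ 4 = 1 :> int by [].
rewrite expr0 expr1 /f3 !add0r !mulrN1 !mulr1.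
move: (level a 2 _) (level a 3 _) (level a 4 _) #|cones a| => b2 b3 b4 c; lia.
Qed.

Lemma pairs_count : (n * n.-1 = h a 2 * 2 + h a 3 * 6)%N.
Proof.
have := card_flat_pairs arr (fun L => simply_laced_weight arr sl (L := L)) (flatT a).
by rewrite cardsT card_ord !lines_inT.
Qed.

Lemma level2T : B 2 = (h a 2)%:Z + 2 * (h a 3)%:Z.
Proof.
have := level2_lines arr (fun L => simply_laced_weight arr sl (L := L)) setT.
by rewrite !lines_inT.
Qed.

Lemma mu_rank3_bound F : flat a F -> rankS a F = 3%N ->
  - mu a F <= 2 * (#|lines_in a F 2| * (#|F| - 2))%N%:Z.
Proof.
move=> fF rF; rewrite mu_rank3 // opprK.
have wl := fun L => simply_laced_weight arr sl (L := L).
rewrite (level2_lines arr wl).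
have := card_flat_pairs arr wl fF; have := double_lines_lower_bound arr fF rF.
have : (0 < #|F|)%N.
  by rewrite card_gt0; apply/eqP => F0; move: rF; rewrite F0 rankS0.
move: #|F| #|lines_in a F 2| #|lines_in a F 3| => m t2 t3 m0 mt e.
case: m m0 mt e => [//|[|k]] _ mt e; first by lia.
have [k0|k0] := posnP k; first by rewrite k0 in mt e *; lia.
(* With m = k + 2, eliminating t3 leaves k^2 - 1 <= t2 (6 k - 1), which follows from m <= 6 t2. *)
have : (k.+2 * (6 * k - 1) <= 6 * t2 * (6 * k - 1))%N by rewrite leq_mul2r mt orbT.
rewrite subn2 /=; nia.
Qed.

(** [B 3] sums the Moebius numbers of the vertices, which [mu_rank3_bound] and [sum_double_lines]
    control together. *)
Lemma f3_upper : (f3 a <= n + 2 * (h a 2 * (n - 2)))%N.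
Proof.
rewrite -lez_nat f3_level PoszD PoszM lerD2l -(sum_double_lines a).
rewrite -[X in _ * X]natz natr_sum mulr_sumr /level -sumrN.
rewrite (eq_bigl (fun F => flat a F && (rankS a F == 3%N))); last first.
  by move=> F; rewrite subsetT andbT.
by apply: ler_sum => F /andP[fF /eqP rF]; rewrite natz mu_rank3_bound.
Qed.

Lemma chi_roots : exists r1 r2 r3 : R,
  [/\ n%:R = 1 + (r1 + r2 + r3),
      (B 2)%:~R = (r1 + r2 + r3) + (r1 * r2 + r1 * r3 + r2 * r3) &
      (f3 a)%:R = (1 + r1) * (1 + r2) * (1 + r3)].
Proof.
have [rs chiE] := rr.
have chiP : chi a = \poly_(i < 5) (B (4 - i))%:~R.
  rewrite chi_level poly_def (reindex_inj rev_ord_inj) /=; apply: eq_bigr => i _.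
  by rewrite !subSS subKn // -ltnS.
have sz : size rs = 4%N.
  apply: succn_inj; rewrite -(size_prod_XsubC rs id) -chiE chiP size_poly_eq //.
  by rewrite subnn level0 // oner_eq0.
have chi_eval x : (chi a).[x] = \prod_(r <- rs) (x - r).
  by rewrite chiE horner_prod; apply: eq_bigr => r _; rewrite hornerXsubC.
have ev x : x ^+ 4 - n%:R * x ^+ 3 + (B 2)%:~R * x ^+ 2 + (B 3)%:~R * x + (B 4)%:~R
    = \prod_(r <- rs) (x - r).
  rewrite -chi_eval chi_level !big_ord_recr big_ord0 /= !hornerE level0 // level1 // cardsT card_ord.
  by rewrite rmorphN /= -pmulrn; ring.
have lev : 1 - n%:R + (B 2)%:~R + (B 3)%:~R + (B 4)%:~R = 0 :> R.
  have := congr1 (fun z : int => z%:~R : R) (sum_level arr).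
  rewrite !big_ord_recr big_ord0 /= level0 // level1 // cardsT card_ord.
  by rewrite !rmorphD rmorphN /= -pmulrn; lra.
have one_root : 1 \in rs.
  have : \prod_(r <- rs) (1 - r) == 0 by rewrite -ev !expr1n !mulr1 lev.
  by rewrite prodf_seq_eq0 => /hasP[r rrs /=]; rewrite subr_eq0 => /eqP ->.
have f3E : (f3 a)%:R = n%:R - (B 3)%:~R :> R.
  by rewrite !pmulrn f3_level rmorphB.
have [p1 p2] : size (rem 1 rs) = 3%N /\ forall x,
    \prod_(r <- rs) (x - r) = (x - 1) * \prod_(r <- rem 1 rs) (x - r).
  split; first by rewrite size_rem // sz.
  by move=> x; rewrite (perm_big _ (perm_to_rem one_root)) big_cons.
case: (rem 1 rs) p1 p2 => [|r1 [|r2 [|r3 [|]]]] // _ p2; exists r1, r2, r3.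
have {}ev x := etrans (ev x) (p2 x).
(* Both sides are monic quartics, so four evaluation points determine the other coefficients
   linearly. *)
have := ev 0; have := ev (-1); have := ev 2; have := ev (-2).
rewrite !big_cons !big_nil f3E; move: (B 4)%:~R (B 3)%:~R (B 2)%:~R n%:R => b4 b3 b2 N.
by move=> v1 v2 v3 v4; split; lra.
Qed.

Lemma natr_pairs : n%:R * (n%:R - 1) = 2 * (h a 2)%:R + 6 * (h a 3)%:R :> R.
Proof.
have n1 : (1 <= n)%N by apply: leq_trans n_ge4.
have := congr1 (fun m => m%:R : R) pairs_count.
by rewrite natrM natrD !natrM -subn1 natrB // => ->; ring.
Qed.

(** The factor 3 allows h3 to be eliminated through 6 h3 = n (n - 1) - 2 h2. *)
Lemma elementary_symmetric : exists x1 x2 x3 : R,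
  [/\ x1 + x2 + x3 = n%:R + 2,
      3 * (x1 * x2 + x1 * x3 + x2 * x3) = 3 * (n%:R + 2) + n%:R * (n%:R - 1) + (h a 2)%:R
    & x1 * x2 * x3 = (f3 a)%:R].
Proof.
have [r1 [r2 [r3 [nE b2E f3E]]]] := chi_roots; have pE := natr_pairs.
rewrite level2T rmorphD rmorphM /= -!pmulrn in b2E.
by exists (1 + r1), (1 + r2), (1 + r3); split; [lra | lra | rewrite f3E].
Qed.

(** e1^2 - 3 e2 equals 2n - 2 - h2. *)
Lemma h2_upper : (h a 2)%:R <= 2 * n%:R - 2 :> R.
Proof.
have [x1 [x2 [x3 [e1 e2 _]]]] := elementary_symmetric.
have := cubic_e1_sqr x1 x2 x3; rewrite e2 e1; lra.
Qed.

Lemma h3_lower : (n%:R - 4) * (n%:R - 1) / 6 <= (h a 3)%:R :> R.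
Proof. by have := h2_upper; have := natr_pairs; lra. Qed.

Lemma f3_le_cube : (f3 a)%:R <= (n%:R + 2) ^+ 3 / 27 :> R.
Proof.
have [x1 [x2 [x3 [e1 e2 e3]]]] := elementary_symmetric.
have n4 : 4 <= n%:R :> R by rewrite (ler_nat R 4 n) n_ge4.
have h0 : 0 <= (h a 2)%:R :> R by rewrite ler0n.
rewrite -e3 -e1; apply: cubic_e3_upper; first by rewrite e1; lra.
have := mulr_ge0 (_ : 0 <= n%:R :> R) (_ : 0 <= n%:R - 1 :> R).
by move=> /(_ ltac:(lra) ltac:(lra)); lra.
Qed.

Lemma f3_lower :
  n%:R ^+ 3 + 6 * n%:R + 20 + 3 * (h a 2)%:R * (n%:R + 2)
    - 2 * Num.sqrt ((2 * n%:R - 2 - (h a 2)%:R) ^+ 3) <= 27 * (f3 a)%:R :> R.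
Proof.
have [x1 [x2 [x3 [e1 e2 e3]]]] := elementary_symmetric.
have := cubic_e3_lower x1 x2 x3; rewrite e3 e1 e2.
have -> : (n%:R + 2) ^+ 2 - (3 * (n%:R + 2) + n%:R * (n%:R - 1) + (h a 2)%:R)
  = 2 * n%:R - 2 - (h a 2)%:R :> R by ring.
by apply: le_trans; rewrite lerD2r le_eqVlt; apply/orP; left; apply/eqP; ring.
Qed.

(* f3 grows like n^3 / 27 by f3_lower but at most like 4 n^2 by f3_upper. *)
Lemma n_le119 : (n <= 119)%N.
Proof.
rewrite leqNgt; apply/negP => n120.
have N120 : 120 <= n%:R :> R by rewrite (ler_nat R 120 n).
have up : (f3 a)%:R <= n%:R + 2 * ((h a 2)%:R * (n%:R - 2)) :> R.
  have n2 : (2 <= n)%N by apply: leq_trans n_ge4.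
  by have := f3_upper; rewrite -(ler_nat R) natrD !natrM natrB.
have low := f3_lower; have hu := h2_upper.
have h0 : 0 <= (h a 2)%:R :> R by rewrite ler0n.
move: (h a 2)%:R (f3 a)%:R (n%:R : R) N120 up low hu h0 => H f N N120 up low hu h0.
set D := 2 * N - 2 - H in low.
have D0 : 0 <= D by rewrite /D; lra.
(* D <= 2 N - 2 <= N^2 gives D^3 <= (N D)^2. *)
have sq : Num.sqrt (D ^+ 3) <= N * D.
  have ND : 0 <= N * D by rewrite mulr_ge0 //; lra.
  rewrite -(ler_pXn2r (n := 2)) // ?nnegrE ?sqrtr_ge0 // sqr_sqrtr ?exprn_ge0 //.
  rewrite exprMn exprS mulrC [leRHS]mulrC ler_wpM2l ?sqr_ge0 //.
  by rewrite /D; nra.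
have key : N ^+ 3 + 6 * N + 20 + 3 * H * (N + 2) <= 27 * (N + 2 * (H * (N - 2))) + 2 * (N * D) by lra.
(* After collecting terms, H enters the upper side of [key] with coefficient 49 N - 114 > 0, so it
   may be replaced by 2 N - 2. This leaves N^3 <= 102 N^2 - 309 N + 208, which fails for N >=
   120. *)
have : 0 <= (2 * N - 2 - H) * (49 * N - 114) by rewrite mulr_ge0 //; lra.
have : 0 <= (N - 120) * N ^+ 2 by rewrite mulr_ge0 ?sqr_ge0 //; lra.
have : 0 <= (N - 120) * N by rewrite mulr_ge0 //; lra.
by move: key; rewrite /D; lra.
Qed.

Lemma grunbaum_shephard_n_le15 : grunbaum_shephard a -> (n <= 15)%N.
Proof.
rewrite /grunbaum_shephard big_ltn ?ltnS ?(leq_trans _ n_ge4) // => gs.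
have h32 : (h a 3).+1%:R <= (h a 2)%:R :> R by rewrite ler_nat (leq_trans _ gs) // ltnS leq_addr.
rewrite leqNgt; apply/negP => n16; have N16 : 16 <= n%:R :> R by rewrite (ler_nat R 16 n).
rewrite -natr1 in h32; have hl := h3_lower; have hu := h2_upper.
(* h3 + 1 <= h2 <= 2n - 2 and the lower bound on h3 give (n - 16)(n - 1) + 6 <= 0. *)
have : 0 <= (n%:R - 16) * (n%:R - 1) :> R by rewrite mulr_ge0 //; lra.
by lra.
Qed.

End Main.

Theorem theorem2 (R : realType) :
  (forall (n : nat) (a : 'I_n -> 'rV[R]_4),
    arrangement a -> simply_laced a -> chi_real_rooted a ->
    [/\ (h a 2 <= 2 * n - 2)%N,
        (n%:R - 4) * (n%:R - 1) / 6 <= (h a 3)%:R :> R,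
        (f3 a)%:R <= (n%:R + 2) ^+ 3 / 27 :> R,
        (n%:R ^+ 3 + 6 * n%:R + 20 + 3 * (h a 2)%:R * (n%:R + 2)
           - 2 * Num.sqrt ((2 * n%:R - 2 - (h a 2)%:R) ^+ 3)) / 27
           <= (f3 a)%:R :> R
      & (simplicial a -> (n <= 119)%N) /\
        (grunbaum_shephard a -> (n <= 15)%N)]) /\
  (forall eps : R, 0 < eps -> exists N : nat,
    forall (n : nat) (a : 'I_n -> 'rV[R]_4),
      arrangement a -> simply_laced a -> chi_real_rooted a -> (N <= n)%N ->
      `| (f3 a)%:R / n%:R ^+ 3 - 1 / 27 | <= eps).
Proof.
split=> [n a arr sl rr|eps eps0]; last first.
  (* No such arrangement has 120 or more hyperplanes, so this threshold serves every [eps]. *)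
  by exists 120%N => n a arr sl rr; rewrite leqNgt ltnS (n_le119 arr sl rr).
have n1 : (2 <= 2 * n)%N by have := n_ge4 arr; lia.
split.
- by rewrite -(ler_nat R) natrB // natrM h2_upper.
- exact: h3_lower.
- exact: f3_le_cube.
- by rewrite ler_pdivrMr // [leRHS]mulrC f3_lower.
by split=> [_|]; [exact: (n_le119 arr sl rr) | exact: grunbaum_shephard_n_le15].
Qed.
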